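(* Let $T>0$ and fix an integer $p\geq 2$. Let $\{S(t)\}_{t\in[0,T]}$ be a free Brownian motion, and let $(F_n)_{n\geq 1}$ be a sequence of multiple Wigner integrals of the form \[ F_n=\int_{[0,T]^p} f_n(t_1,\ldots,t_p)\,dS(t_1)\ldots dS(t_p), \] where each $f_n\in L^2([0,T]^p;\mathbb{R})$ is mirror symmetric, that is, satisfies $f_n(t_1,\ldots,t_p)=f_n(t_p,\ldots,t_1)$ for all $t_1,\ldots,t_p\in[0,T]$. Suppose moreover that $E[F_n^2]\to 1$ as $n\to\infty$. Then, as $n\to\infty$, the following two assertions are equivalent: (i) for all $k\geq 3$, $E[F_n^k]\to E[S(1)^k]$; (ii) $E[F_n^4]\to E[S(1)^4]=2$. Here $S(1)$ denotes a centered semicircular random variable with variance $1$.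
   Context: A free Brownian motion is a process $\{S(t)\}$ of self-adjoint elements of a non-commutative probability space $(\mathscr{A},E)$ (in the standard setting of free stochastic analysis, a von Neumann algebra with a faithful normal tracial state $E$), starting from $0$, with freely independent increments, and such that $S(t)-S(s)$ is a centered semicircular random variable with variance $t-s$ for all $t\geq s$. A centered semicircular variable of variance $1$ has the moments of the density $\frac{1}{2\pi}\sqrt{4-x^2}$ on $[-2,2]$. Multiple Wigner integral: let $D^p\subset[0,T]^p$ be the set of points $(t_1,\ldots,t_p)$ with $t_i=t_j$ for some $i\neq j$. For $f=\mathbf{1}_A$ with $A=[u_1,v_1]\times\cdots\times[u_p,v_p]\subset[0,T]^p$ and $A\cap D^p=\emptyset$, set $\int_{[0,T]^p} f\,dS\ldots dS=I_p(f)=(S(v_1)-S(u_1))\cdots(S(v_p)-S(u_p))$ (ordered product). Extend by linearity to linear combinations of indicators of disjoint such rectangles, and then to all real-valued $f\in L^2([0,T]^p)$ by approximation, using $E[I_p(f)I_p(g)]=\langle f,g^*\rangle_{L^2([0,T]^p)}$, where $g^*(t_1,\ldots,t_p)=g(t_p,\ldots,t_1)$. *)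

(* Defs.v *)
From HB Require Import structures.
From mathcomp Require Import all_boot all_order all_algebra complex.
From mathcomp Require Import all_classical all_reals all_analysis.

Set Implicit Arguments.
Unset Strict Implicit.
Unset Printing Implicit Defensive.

Import Order.TTheory GRing.Theory Num.Theory.
Import numFieldNormedType.Exports.

Local Open Scope classical_set_scope.
Local Open Scope ring_scope.

Section lebesgue_tuple.
Variable R : realType.

Definition cons_pair n (x : R * n.-tuple R) : n.+1.-tuple R :=
  [tuple of x.1 :: x.2].

Lemma measurable_cons_pair n :
  measurable_fun [set: R * n.-tuple R] (@cons_pair n).
Proof. exact: measurable_cons measurable_fst measurable_snd. Qed.

Section step.
Variables (n : nat) (mu : {sigma_finite_measure set (n.-tuple R) -> \bar R}).

Definition lebesgue_cons : set (n.+1.-tuple R) -> \bar R :=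
  pushforward (lebesgue_measure \x mu)%E (@cons_pair n).

Let mcons := @measurable_cons_pair n.

Let lebesgue_cons0 : lebesgue_cons set0 = 0%E.
Proof. by rewrite /lebesgue_cons /pushforward preimage_set0 measure0. Qed.

Let lebesgue_cons_ge0 A : (0 <= lebesgue_cons A)%E.
Proof. exact: measure_ge0. Qed.

Let lebesgue_cons_sigma_additive : semi_sigma_additive lebesgue_cons.
Proof.
move=> F mF tF mUF; rewrite /lebesgue_cons /pushforward preimage_bigcup.
apply: measure_semi_sigma_additive.
- by move=> k; rewrite -[X in measurable X]setTI; exact: mcons.
- apply/trivIsetP => /= i j _ _ ij; rewrite -preimage_setI.
  by move/trivIsetP : tF => /(_ _ _ _ _ ij) ->//; rewrite preimage_set0.
- by rewrite -preimage_bigcup -[X in measurable X]setTI; exact: mcons.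
Qed.

HB.instance Definition _ := isMeasure.Build _ _ _ lebesgue_cons
  lebesgue_cons0 lebesgue_cons_ge0 lebesgue_cons_sigma_additive.

Let lebesgue_cons_sigma_finite : sigma_finite setT lebesgue_cons.
Proof.
have /sigma_finiteP[F [FT ndF Foo]] := sigma_finiteT (@lebesgue_measure R).
have /sigma_finiteP[G [GT ndG Goo]] := sigma_finiteT mu.
have mthead : measurable_fun [set: n.+1.-tuple R] (fun t => tnth t ord0).
  exact: measurable_tnth.
have mtbehead := @measurable_behead _ R n.
pose K k := (fun t : n.+1.-tuple R => tnth t ord0) @^-1` F k `&`
            (fun t : n.+1.-tuple R => [tuple of behead t]) @^-1` G k.
exists K.
  rewrite predeqE => t; split => // _.
  have [a _ Fa] : (\bigcup_i F i) (tnth t ord0) by rewrite -FT.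
  have [b _ Gb] : (\bigcup_i G i) [tuple of behead t] by rewrite -GT.
  exists (maxn a b) => //; split.
  - by have /subsetPset := ndF _ _ (leq_maxl a b); exact.
  - by have /subsetPset := ndG _ _ (leq_maxr a b); exact.
move=> k; have [mF Fk] := Foo k; have [mG Gk] := Goo k; split.
  apply: measurableI; rewrite -[X in measurable X]setTI.
  - exact: mthead.
  - exact: mtbehead.
have -> : lebesgue_cons (K k) = (lebesgue_measure \x mu)%E (F k `*` G k).
  rewrite /lebesgue_cons /pushforward; congr (_ _).
  apply/seteqP; split=> -[x t] [/= Fx Gt]; split=> //=.
  - by move: Gt; congr (G k _); exact: val_inj.
  - by move: Gt; congr (G k _); exact: val_inj.
by rewrite product_measure1E// lte_mul_pinfty// ge0_fin_numE.
Qed.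

HB.instance Definition _ := Measure_isSigmaFinite.Build _ _ _ lebesgue_cons
  lebesgue_cons_sigma_finite.

End step.

Fixpoint lebesgue_tuple n : {sigma_finite_measure set (n.-tuple R) -> \bar R} :=
  match n return {sigma_finite_measure set (n.-tuple R) -> \bar R} with
  | 0%N => \d_[tuple]
  | m.+1 => lebesgue_cons (lebesgue_tuple m)
  end.

End lebesgue_tuple.

Section box.
Variable R : realType.

Definition box n (u v : n.-tuple R) : set (n.-tuple R) :=
  [set t | forall i, tnth u i <= tnth t i <= tnth v i].

Lemma measurable_box n (u v : n.-tuple R) : measurable (box u v).
Proof.
have -> : box u v = \bigcap_(i in [set: 'I_n]) ((fun t : n.-tuple R => tnth t i) @^-1` `[tnth u i, tnth v i]).
  by apply/seteqP; split => t /= H i; [move=> _; rewrite /= in_itv/=; exact: H | have := H i I; rewrite /= in_itv].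
apply: fin_bigcap_measurable; first exact: finite_finset.
move=> i _; rewrite -[X in measurable X]setTI.
exact: measurable_tnth.
Qed.

Lemma lebesgue_tuple_box n (u v : n.-tuple R) :
  (forall i, tnth u i <= tnth v i) ->
  lebesgue_tuple R n (box u v) = (\prod_(i < n) (tnth v i - tnth u i))%:E.
Proof.
elim: n u v => [u v _|n IH u v uv] /=.
  rewrite big_ord0 diracE mem_set//; by case.
pose u' := [tuple of behead u]; pose v' := [tuple of behead v].
have E0 : @cons_pair R n @^-1` box u v = `[tnth u ord0, tnth v ord0]%classic `*` box u' v'.
  apply/seteqP; split => -[x t] /=.
    move=> H; split => /=; first by have := H ord0; rewrite in_itv.
    move=> i; have := H (lift ord0 i).
    by rewrite tnthS /= (tuple_eta u) (tuple_eta v) !tnthS /=; congr (is_true (_ <= _ <= _)); congr (tnth _ i); exact: val_inj.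
  rewrite in_itv/= => -[H0 H] i.
  case: (unliftP ord0 i) => [j|] -> //.
  have := H j.
  by rewrite tnthS /= (tuple_eta u) (tuple_eta v) !tnthS /=; congr (is_true (_ <= _ <= _)); congr (tnth _ j); exact: val_inj.
rewrite /lebesgue_cons /pushforward E0 product_measure1E//; last exact: measurable_box.
rewrite [X in (_ * X)%E](IH u' v'); last first.
  by move=> i; have := uv (lift ord0 i); rewrite (tuple_eta u) (tuple_eta v) !tnthS; congr (is_true (tnth _ i <= tnth _ i)); exact: val_inj.
have LE : lebesgue_measure (`[tnth u ord0, tnth v ord0]%classic : set R) = (tnth v ord0 - tnth u ord0)%:E.
  rewrite lebesgue_measure_itv/= lte_fin; case: ifPn => [_|]; first by rewrite EFinB.
  rewrite -leNgt => vu; have -> : tnth v ord0 = tnth u ord0 by apply/eqP; rewrite eq_le vu uv.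
  by rewrite subrr.
transitivity ((tnth v ord0 - tnth u ord0)%:E * (\prod_(i < n) (tnth v' i - tnth u' i))%:E)%E.
  by rewrite -LE.
rewrite big_ord_recl.
have -> : \prod_(i < n) (tnth v (lift ord0 i) - tnth u (lift ord0 i)) = \prod_(i < n) (tnth v' i - tnth u' i).
  by apply: eq_bigr => i _; rewrite {1}(tuple_eta u) {1}(tuple_eta v) !tnthS; congr (tnth _ i - tnth _ i); exact: val_inj.
by rewrite EFinM.
Qed.

End box.

Section noncommutative_probability.
Local Open Scope complex_scope.
Variables (R : realType) (A : algType R[i]) (star : A -> A).

Record is_star_algebra : Prop := {
  starK : forall a, star (star a) = a;
  starM : forall a b, star (a * b) = star b * star a;
  starP : forall (c : R[i]) a b,
    star (c *: a + b) = Num.conj c *: star a + star b }.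

(* [rho] realizes [A] as a unital star-algebra of bounded operators on the
   Hilbert space [H], closed in the weak operator topology. The adjoint is
   given by [rho_star]; a basic weak-operator neighbourhood of [Op] is given by
   finitely many matrix coefficients. *)
Record is_vN_representation (H : completeNormedModType R[i])
    (ip : {dot H for (@Num.conj R[i])}) (rho : A -> {linear H -> H}) : Prop := {
  ip_norm : forall x, ip x x = `|x| ^+ 2;
  rho_bounded : forall a, continuous (rho a);
  rhoP : forall (c : R[i]) a b x, rho (c *: a + b) x = c *: rho a x + rho b x;
  rho1 : forall x, rho 1 x = x;
  rhoM : forall a b x, rho (a * b) x = rho a (rho b x);
  rho_star : forall a x y, ip (rho a x) y = ip x (rho (star a) y);
  rho_inj : forall a b, rho a =1 rho b -> a = b;
  rho_closed : forall Op : {linear H -> H}, continuous Op ->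
    (forall (n : nat) (x y : 'I_n -> H) (e : R[i]), 0 < e ->
      exists a, forall k, `|ip (Op (x k) - rho a (x k)) (y k)| < e) ->
    exists a, rho a =1 Op }.

Definition von_neumann_algebra : Prop := is_star_algebra /\
  exists (H : completeNormedModType R[i])
    (ip : {dot H for (@Num.conj R[i])}) (rho : A -> {linear H -> H}),
    is_vN_representation ip rho.

(* In a von Neumann algebra the positive elements are those of the form
   [star c * c]. *)
Definition star_le (a b : A) : Prop := exists c, b - a = star c * c.

Variable E : {scalar A}.

(* [E] preserves least upper bounds of directed sets of self-adjoint elements;
   that [E s] is an upper bound follows from positivity. *)
Definition normal_functional : Prop :=
  forall (D : set A) (s : A), D !=set0 ->
    (forall a, D a -> star a = a) ->
    (forall a b, D a -> D b -> exists2 c, D c & star_le a c /\ star_le b c) ->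
    star s = s ->
    (forall a, D a -> star_le a s) ->
    (forall b, star b = b -> (forall a, D a -> star_le a b) -> star_le s b) ->
  forall c : R[i], (forall a, D a -> E a <= c) -> E s <= c.

Record is_Wstar_probability_space : Prop := {
  ncps_vN : von_neumann_algebra;
  ncps_pos : forall a, 0 <= E (star a * a);
  ncps_unit : E 1 = 1;
  ncps_tracial : forall a b, E (a * b) = E (b * a);
  ncps_faithful : forall a, E (star a * a) = 0 -> a = 0;
  ncps_normal : normal_functional }.

(* Free independence of self-adjoint elements, i.e. of the unital algebras
   [{horner_alg (X i) q | q}] which they generate. *)
Definition freely_independent n (X : 'I_n -> A) : Prop :=
  forall (m : nat) (i : 'I_m.+1 -> 'I_n) (q : 'I_m.+1 -> {poly R[i]}),
    (forall a b : 'I_m.+1, b = a.+1 :> nat -> i a != i b) ->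
    (forall a, E (horner_alg (X (i a)) (q a)) = 0) ->
  E (\prod_(a < m.+1) horner_alg (X (i a)) (q a)) = 0.

Definition semicircle_moment (k : nat) : R :=
  \int[lebesgue_measure]_(x in `[-2, 2]%classic)
    (x ^+ k * (Num.sqrt (4 - x ^+ 2) / (2 * pi))).

(* Variance [v]: the law of [Num.sqrt v] times a semicircular variable of
   variance 1. *)
Definition semicircular (X : A) (v : R) : Prop := star X = X /\
  forall k, E (X ^+ k) = (Num.sqrt v ^+ k * semicircle_moment k)%:C.

Variable T : R.

Record free_brownian_motion (S : R -> A) : Prop := {
  fbm_selfadjoint : forall t, 0 <= t <= T -> star (S t) = S t;
  fbm0 : S 0 = 0;
  fbm_semicircular : forall s t, 0 <= s -> s <= t -> t <= T ->
    semicircular (S t - S s) (t - s);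
  fbm_free : forall (n : nat) (t : nat -> R), 0 <= t 0%N ->
    (forall i, (i < n)%N -> t i < t i.+1) -> t n <= T ->
    freely_independent (fun i : 'I_n => S (t i.+1) - S (t i)) }.

Variable p : nat.

Definition cube : set (p.-tuple R) := [set t | forall i, 0 <= tnth t i <= T].

Definition diagonals : set (p.-tuple R) :=
  [set t | exists i j, i != j /\ tnth t i = tnth t j].

Definition square_integrable (f : p.-tuple R -> R) : Prop :=
  measurable_fun cube f /\
  (\int[lebesgue_tuple R p]_(t in cube) ((f t) ^+ 2)%:E < +oo)%E.

Definition mirror_symmetric (f : p.-tuple R -> R) : Prop :=
  forall t, cube t -> f t = f [tuple of rev t].

Definition admissible_boxes m (u v : 'I_m -> p.-tuple R) : Prop :=
  [/\ forall j i, 0 <= tnth (u j) i /\ tnth (u j) i <= tnth (v j) i <= T,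
      forall j, box (u j) (v j) `&` diagonals = set0 &
      trivIset setT (fun j => box (u j) (v j))].

Definition simple_function m (c : 'I_m -> R) (u v : 'I_m -> p.-tuple R)
    (t : p.-tuple R) : R :=
  \sum_(j < m) c j * \1_(box (u j) (v j)) t.

Definition simple_wigner_integral (S : R -> A) m (c : 'I_m -> R)
    (u v : 'I_m -> p.-tuple R) : A :=
  \sum_(j < m) (c j)%:C *: \prod_(i < p) (S (tnth (v j) i) - S (tnth (u j) i)).

(* [(f, F)] lies in the closure, in L^2([0,T]^p) x L^2(A, E), of the graph of
   the integral on simple functions. The latter being isometric and [E]
   faithful, at most one [F] satisfies this for a given [f]. *)
Definition is_wigner_integral (S : R -> A) (f : p.-tuple R -> R) (F : A)
    : Prop :=
  forall e : R, 0 < e ->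
  exists (m : nat) (c : 'I_m -> R) (u v : 'I_m -> p.-tuple R),
    let F' := F - simple_wigner_integral S c u v in
    [/\ admissible_boxes u v,
        (\int[lebesgue_tuple R p]_(t in cube)
           ((f t - simple_function c u v t) ^+ 2)%:E < e%:E)%E &
        E (star F' * F') < e%:C].

End noncommutative_probability.

(* Main.v *)
(* On the grid of all end points of its boxes, a simple Wigner integral is a
   homogeneous polynomial in free standard semicircular variables, off the
   diagonals, hence a combination of Wick words, which form an orthonormal family
   of L2 and multiply by contractions. Let G be such a polynomial with mirror
   symmetric kernel g of degree p and put s = |g|^2 = E(G^2). The product formula
   gives E(G^4) = 2 s^2 + eps, where eps is the sum of the squared norms of the
   contractions of g with itself of orders 1, ..., p - 1. If B_j denotes the Wick
   sum of the j-th tensor power of g, then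
     G B_(j+1) = B_(j+2) + s B_j + D_j,   |D_j|^2 = eps s^j,
   which for s = 1 and eps = 0 is the recursion of the Chebyshev polynomials in a
   semicircular variable S1. As |G^k| is bounded in terms of p, k and s by
   Haagerup's inequality, s -> 1 and eps -> 0 imply, by induction on k, that
   E(G^k B_j) -> E(S1^k U_j(S1)) for all j; the case j = 0 is the claim. The same
   bound allows one to replace general integrals by simple ones. *)

From HB Require Import structures.
Require Import Defs.
From mathcomp Require Import all_boot all_order all_algebra complex.
From mathcomp Require Import all_classical all_reals all_analysis.
From mathcomp Require Import measurable_realfun.
From mathcomp Require Import ring lra zify.

Set Implicit Arguments.
Unset Strict Implicit.
Unset Printing Implicit Defensive.

Import Order.TTheory GRing.Theory Num.Theory.
Import numFieldNormedType.Exports.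
Import Normc.

Local Open Scope classical_set_scope.
Local Open Scope ring_scope.

(** * Wick words in free semicircular variables *)

(** Chebyshev polynomials of the second kind rescaled to [-2, 2], that is sin((n+1)t) / sin t as a
    polynomial in 2 cos t: the monic orthogonal polynomials of the semicircle law. *)
Fixpoint chebyshev (K : nzRingType) (n : nat) : {poly K} :=
  match n with
  | 0 => 1
  | n1.+1 => match n1 with
             | 0 => 'X
             | n2.+1 => 'X * chebyshev K n1 - chebyshev K n2
             end
  end.

Section words.
Local Open Scope complex_scope.
Variables (R : realType) (A : algType R[i]) (N : nat) (Y : 'I_N -> A).
Implicit Types (w u v x y : seq 'I_N) (i j : 'I_N).

(* For free standard semicircular [Y], [wick w] is the element of [A] which maps
   the vacuum of the full Fock space to the basis vector [e_w], and the recursion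
   says that [Y i] acts there as the sum of the creation and annihilation
   operators of [e_i]. *)
Fixpoint wick w : A :=
  match w with
  | [::] => 1
  | i :: w1 => Y i * wick w1 - (match w1 with
                                | [::] => 0
                                | j :: w2 => if i == j then wick w2 else 0
                                end)
  end.

Lemma wick_cons2 i j w :
  wick [:: i, j & w] = Y i * wick (j :: w) - (i == j)%:R *: wick w.
Proof. by rewrite /=; case: eqP => _; rewrite ?scale1r ?scale0r. Qed.

Lemma wick1 i : wick [:: i] = Y i.
Proof. by rewrite /= mulr1 subr0. Qed.

Lemma mulY_wick i j w :
  Y i * wick (j :: w) = wick [:: i, j & w] + (i == j)%:R *: wick w.
Proof. by rewrite wick_cons2 subrK. Qed.

(** The recursion for [wick] multiplies on the left; by this mirror image both ends of a word obey
    the same rule. The induction is on the length because the recursion may remove two letters. *)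
Lemma wick_mulY w i j :
  wick (rcons w j) * Y i = wick (rcons (rcons w j) i) + (i == j)%:R *: wick w.
Proof.
have [n] := ubnP (size w); elim: n w => // n IH [|k [|l w]] sw.
- by rewrite /= !mulr1 !subr0 [j == i]eq_sym; case: eqP => [->|_];
    rewrite ?scale1r ?scale0r ?subrK // subr0 addr0.
- rewrite /= !mulr1 !subr0 [j == i]eq_sym mulrBl -mulrA mulrBr.
  by case: (k == j); case: (i == j);
    rewrite ?(mulr1, mulr0, mul1r, mul0r, scale1r, scale0r, subr0, addr0, subrK) // addrAC subrK.
- have IH1 := IH (l :: w) sw; have IH2 := IH w (ltnW sw).
  rewrite !rcons_cons in IH1 *; rewrite !wick_cons2 mulrBl -mulrA IH1 -scalerAl IH2.
  move: (wick (l :: w)) (wick w) (wick (l :: _)) (wick _) => b d a c.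
  rewrite mulrDr scalerDr -scalerAr scalerBr !scalerA opprD [(k == l)%:R * _]mulrC.
  by rewrite !addrA; congr (_ - _); rewrite addrAC.
Qed.

(** Peeling [i] off the left word leaves a contraction of [i] with its left neighbour, which cancels
    against the one produced by the induction hypothesis. *)
Lemma wick_rconsM x i j v :
  wick (rcons x i) * wick (j :: v) =
  wick (rcons x i ++ j :: v) + (i == j)%:R *: (wick x * wick v).
Proof.
have [n] := ubnP (size x); elim: n x i j v => // n IH x i j v.
case/lastP: x => [|x k] sx; first by rewrite wick1 mul1r mulY_wick.
rewrite -[wick (rcons (rcons x k) i)](addrK ((i == k)%:R *: wick x)) -wick_mulY.
rewrite mulrBl -mulrA mulY_wick mulrDr IH; last by rewrite size_rcons in sx.
rewrite -scalerAr -scalerAl [k == i]eq_sym !cat_rcons addrAC -addrA.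
by rewrite -addrA addNKr.
Qed.

(** Product formula, obtained by iterating [wick_rconsM]; [r] counts the pairs contracted at the
    junction. Reversing the left word turns the nested pairing into an equality of prefixes. *)
Lemma wick_revM u v :
  wick (rev u) * wick v =
  \sum_(r < (minn (size u) (size v)).+1)
     (take r u == take r v)%:R *: wick (rev (drop r u) ++ drop r v).
Proof.
elim: u v => [|i u IH] v.
  by rewrite min0n big_ord1 !take0 eqxx scale1r !drop0 mul1r.
case: v => [|j v].
  by rewrite minn0 big_ord1 !take0 eqxx scale1r !drop0 mulr1 cats0.
rewrite rev_cons wick_rconsM IH minnSS [RHS]big_ord_recl !take0 !drop0 eqxx scale1r rev_cons.
congr (_ + _); rewrite scaler_sumr; apply: eq_bigr => r _.
by rewrite scalerA -natrM mulnb.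
Qed.

End words.

(** * The L2 seminorm of a tracial state *)

Lemma normc_ge0 (R : rcfType) (z : R[i]) : 0 <= normc z.
Proof. by case: z => u v; exact: sqrtr_ge0. Qed.

Section tracial_L2.
Local Open Scope complex_scope.
Variables (R : realType) (A : algType R[i]) (star : A -> A) (E : {scalar A}).
Hypothesis hAE : is_Wstar_probability_space star E.
Implicit Types (a b x y : A).

Let hst : is_star_algebra star.
Proof. by have [[]] := hAE. Qed.

Lemma star_linear (c : R[i]) a b : star (c *: a + b) = c^*%C *: star a + star b.
Proof. exact: (starP hst). Qed.

Let conj1 : (1 : R[i])^*%C = 1. Proof. exact: conjc1. Qed.

Lemma star0 : star 0 = 0.
Proof.
have := star_linear 1 0 0; rewrite scale1r addr0 conj1 scale1r => /eqP.
by rewrite -subr_eq0 opprD addNKr oppr_eq0 => /eqP.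
Qed.

Lemma starD a b : star (a + b) = star a + star b.
Proof. by have := star_linear 1 a b; rewrite conj1 !scale1r. Qed.

Lemma starZ (c : R[i]) a : star (c *: a) = c^*%C *: star a.
Proof. by have := star_linear c a 0; rewrite star0 !addr0. Qed.

Lemma starN a : star (- a) = - star a.
Proof. by rewrite -scaleN1r starZ rmorphN1 scaleN1r. Qed.

Lemma starB a b : star (a - b) = star a - star b.
Proof. by rewrite starD starN. Qed.

Lemma star1 : star 1 = 1.
Proof.
have := starM hst (star 1) 1; rewrite mulr1 (starK hst) => h.
by rewrite [RHS]h mulr1.
Qed.

Lemma starX a n : star (a ^+ n) = star a ^+ n.
Proof.
by elim: n => [|n IH]; rewrite ?expr0 ?star1 // exprS (starM hst) IH -exprSr.
Qed.

Lemma star_sum (I : Type) (r : seq I) (P : pred I) (F : I -> A) :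
  star (\sum_(i <- r | P i) F i) = \sum_(i <- r | P i) star (F i).
Proof. exact: (big_morph star starD star0). Qed.

Lemma Im_E_square a : complex.Im (E (star a * a)) = 0.
Proof. exact/ger0_Im/(ncps_pos hAE). Qed.

(** Polarization: positivity at [1 + a] and at [1 + 'i%C *: a] forces the sum of [E a] and
    [E (star a)], and ['i%C] times their difference, to be real. *)
Lemma E_star a : E (star a) = (E a)^*%C.
Proof.
have h1 : complex.Im (E a + E (star a)) = 0.
  have := Im_E_square (1 + a); rewrite starD star1 mulrDl !mulrDr !mul1r mulr1.
  rewrite !linearD /= (ncps_unit hAE) => h; rewrite -[RHS]h {h}.
  move: (Im_E_square a); case: (E (star a * a)) => u v /= ->.
  by case: (E a) (E (star a)) => a1 a2 [b1 b2] /=; ring.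
have h2 : complex.Im ('i%C * E a - 'i%C * E (star a)) = 0.
  have := Im_E_square (1 + 'i%C *: a).
  rewrite starD star1 starZ mulrDl !mulrDr !mul1r mulr1 -!scalerAl -!scalerAr.
  rewrite !linearD !linearZ /= (ncps_unit hAE) => h; rewrite -[RHS]h {h}.
  have := Im_E_square a.
  case: (E (star a * a)) => u v /= ->; case: (E a) (E (star a)) => a1 a2 [b1 b2] /=.
  by rewrite /GRing.scale /=; ring.
move: h1 h2; case: (E a) (E (star a)) => a1 a2 [b1 b2] /=.
rewrite !mul0r !mul1r ?addr0 ?add0r => h1 h2.
have -> : b1 = a1 by lra.
by have -> : b2 = - a2 by lra.
Qed.

Definition nrm a : R := Num.sqrt (complex.Re (E (star a * a))).

Lemma nrm_ge0 a : 0 <= nrm a.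
Proof. exact: sqrtr_ge0. Qed.

Lemma nrm_sq a : E (star a * a) = (nrm a ^+ 2)%:C.
Proof.
have := ncps_pos hAE a; rewrite lecE /= => /andP[/eqP h1 h2].
rewrite /nrm sqr_sqrtr //; move: h1; case: (E _) => u v /= ->; by [].
Qed.

Lemma nrm_star a : nrm (star a) = nrm a.
Proof. by rewrite /nrm (starK hst) (ncps_tracial hAE). Qed.

Lemma nrmZ (c : R[i]) a : nrm (c *: a) = normc c * nrm a.
Proof.
apply/eqP; rewrite -(@eqrXn2 _ 2) ?nrm_ge0 ?mulr_ge0 ?nrm_ge0 ?normc_ge0 //.
apply/eqP/complexI; rewrite -nrm_sq starZ -scalerAl -scalerAr !linearZ /= nrm_sq.
move: (nrm a) => r; case: c => u v; rewrite /normc exprMn sqr_sqrtr ?addr_ge0 ?sqr_ge0 //.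
by rewrite /GRing.scale /=; simpc; congr (_ +i* _); ring.
Qed.

Lemma nrm_sqD a (l : R[i]) b :
  nrm (a + l *: b) ^+ 2 = nrm a ^+ 2 + 2 * complex.Re (l * E (star a * b))
    + normc l ^+ 2 * nrm b ^+ 2.
Proof.
apply: complexI; rewrite -nrm_sq; set X := (X in _ = X).
rewrite starD starZ mulrDl !mulrDr -!scalerAl -!scalerAr.
rewrite !linearD !linearZ /= !nrm_sq.
have -> : star b * a = star (star a * b) by rewrite (starM hst) (starK hst).
rewrite E_star /X {X}; move: (nrm a) (nrm b) => r q; case: l (E _) => u v [s t].
rewrite /normc /= sqr_sqrtr ?addr_ge0 ?sqr_ge0 //.
by rewrite /GRing.scale /=; simpc; congr (_ +i* _); ring.
Qed.

Lemma nrm_CS a b : normc (E (star a * b)) <= nrm a * nrm b.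
Proof.
have c0 : 0 <= normc (E (star a * b)) := normc_ge0 _.
rewrite -(@ler_pXn2r _ 2) ?nnegrE ?mulr_ge0 ?nrm_ge0 // exprMn.
set c := E _ in c0 *.
(* The squared norm of [a] minus [t] times the conjugate of [c] times [b], as a quadratic polynomial
   in the real [t]. *)
have key (t : R) : 0 <= nrm a ^+ 2 - 2 * t * normc c ^+ 2
                        + t ^+ 2 * normc c ^+ 2 * nrm b ^+ 2.
  have := sqr_ge0 (nrm (a + (- t%:C * c^*%C) *: b)).
  rewrite nrm_sqD -/c; congr (_ <= _); move: (nrm a) (nrm b) => r q.
  case: c c0 => u v _.
  by rewrite /normc /= !sqr_sqrtr ?addr_ge0 ?sqr_ge0 //=; ring.
have [b0|b0] := eqVneq (nrm b ^+ 2) 0.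
  rewrite b0 mulr0; have [//|cgt] := leP (normc c ^+ 2) 0.
  (* With [nrm b = 0] the polynomial is affine in [t], and at this [t] it equals -1. *)
  have := key ((nrm a ^+ 2 + 1) / (2 * normc c ^+ 2)).
  rewrite b0 mulr0 addr0 [2 * _]mulrC -mulrA mulfVK; last by rewrite mulf_neq0 ?gt_eqF.
  lra.
have bgt : 0 < nrm b ^+ 2 by rewrite lt_neqAle eq_sym b0 sqr_ge0.
have := key (nrm b ^+ 2)^-1.
set B := nrm b ^+ 2 in b0 bgt *; set X := nrm a ^+ 2; set Z := normc c ^+ 2.
have -> : X - 2 * B^-1 * Z + B^-1 ^+ 2 * Z * B = (X * B - Z) / B by field.
by rewrite pmulr_lge0 ?invr_gt0 // subr_ge0.
Qed.

Lemma nrm_CSM a b : normc (E (a * b)) <= nrm a * nrm b.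
Proof. by have := nrm_CS (star a) b; rewrite (starK hst) nrm_star. Qed.

Lemma nrmD a b : nrm (a + b) <= nrm a + nrm b.
Proof.
rewrite -(@ler_pXn2r _ 2) ?nnegrE ?addr_ge0 ?nrm_ge0 //.
have := nrm_sqD a 1 b; rewrite scale1r mul1r normc1 expr1n mul1r => ->.
have := nrm_CS a b; set c := E _; set X := _ * _ => hc.
suff : complex.Re c <= normc c by rewrite sqrrD -/X mulr2n; lra.
case: c {hc} => u v /=; apply: le_trans (ler_norm _) _.
by rewrite -sqrtr_sqr ler_wsqrtr // lerDl sqr_ge0.
Qed.

Lemma nrm0 : nrm 0 = 0.
Proof. by rewrite -(scale0r 0) nrmZ normc0 mul0r. Qed.

Lemma nrmN a : nrm (- a) = nrm a.
Proof. by rewrite -scaleN1r nrmZ normcN normc1 mul1r. Qed.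

End tracial_L2.

(** * Orthonormality of Wick words *)

Section free_family.
Local Open Scope complex_scope.
Variables (R : realType) (A : algType R[i]) (star : A -> A) (E : {scalar A}).

(** The last field encodes the standard semicircular law: these polynomials are monic of every
    positive degree, so with [E 1 = 1] their expectations determine all moments. In this form they
    are the centred factors to which freeness applies. *)
Record free_semicircular_family (N : nat) (Y : 'I_N -> A) : Prop := {
  fsf_star : forall i, star (Y i) = Y i;
  fsf_free : freely_independent E Y;
  fsf_chebyshev : forall i k, E (horner_alg (Y i) (chebyshev _ k.+1)) = 0 }.

Hypothesis hAE : is_Wstar_probability_space star E.
Variables (N : nat) (Y : 'I_N -> A).
Hypothesis hY : free_semicircular_family Y.
Implicit Types (w u v x y : seq 'I_N) (i j : 'I_N).

(* The maximal runs [(i, k)], that is [k.+1] consecutive letters [i]. *)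
Fixpoint runs w : seq ('I_N * nat) :=
  match w with
  | [::] => [::]
  | i :: w1 => match runs w1 with
               | [::] => [:: (i, 0)]
               | (j, k) :: r => if i == j then (j, k.+1) :: r
                                else [:: (i, 0), (j, k) & r]
               end
  end%N.

Let runs_prod (r : seq ('I_N * nat)) : A :=
  \prod_(x <- r) horner_alg (Y x.1) (chebyshev _ x.2.+1).

(** A Wick word factors into Chebyshev polynomials over its runs. The word without its first letter
    is carried along because lengthening a run uses the three-term recursion, which involves two
    consecutive polynomials. *)
Lemma wick_cons_runs i w : exists k r,
  [/\ runs (i :: w) = (i, k) :: r, wick Y (i :: w) = runs_prod ((i, k) :: r) &
      wick Y w = horner_alg (Y i) (chebyshev _ k) * runs_prod r].
Proof.
elim: w i => [|j w IH] i.
  exists 0%N, [::]; split => //; rewrite ?wick1 /runs_prod ?big_seq1 ?big_nil /=.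
    by rewrite horner_algX.
  by rewrite rmorph1 mulr1.
have [k [r [rE jE wE]]] := IH j.
have -> : runs (i :: j :: w) = match runs (j :: w) with
    | [::] => [:: (i, 0%N)]
    | (j, k) :: r => if i == j then (j, k.+1) :: r else [:: (i, 0%N), (j, k) & r]
    end by [].
rewrite rE wick_cons2; case: eqP => [->|_].
  exists k.+1, r; split => //; last by rewrite jE /runs_prod big_cons.
  rewrite jE wE /runs_prod !big_cons /= scale1r -{1}(horner_algX (Y j)).
  by rewrite !mulrA -rmorphM -mulrBl -rmorphB.
exists 0%N, ((j, k) :: r); split => //; last by rewrite /= rmorph1 mul1r.
by rewrite jE /runs_prod [RHS]big_cons /= horner_algX scale0r subr0.
Qed.

Lemma runs_sorted w : sorted (fun x y : 'I_N * nat => x.1 != y.1) (runs w).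
Proof.
elim: w => //= i w; case: (runs w) => // -[j k] r.
by case: eqP => [_|/eqP ij] /=; [case: r | rewrite ij].
Qed.

(** Neighbouring runs have different letters and their Chebyshev factors are centred, so this is an
    instance of freeness. *)
Lemma E_wick w : w != [::] -> E (wick Y w) = 0.
Proof.
case: w => // i w _; have := runs_sorted (i :: w).
have [k [r [-> -> _]]] := wick_cons_runs i w.
set s := _ :: r => srt.
rewrite /runs_prod (big_nth (i, k)) big_mkord.
apply: (fsf_free hY (i := fun a => (nth (i, k) s a).1)
                    (q := fun a => chebyshev _ (nth (i, k) s a).2.+1)) => [a b ba|a].
  rewrite ba; have /(sortedP (i, k)) := srt; apply.
  by rewrite -ba; exact: ltn_ord.
exact: fsf_chebyshev.
Qed.

Lemma E_wick_eq w : E (wick Y w) = (w == [::])%:R.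
Proof. by case: eqVneq => [->|/E_wick //]; rewrite /= (ncps_unit hAE). Qed.

Lemma star_wick w : star (wick Y w) = wick Y (rev w).
Proof.
have st : is_star_algebra star by have [[]] := hAE.
have [n] := ubnP (size w); elim: n w => // n IH [|i [|j w]] sw.
- exact: star1 hAE.
- by rewrite (_ : rev [:: i] = [:: i]) // wick1 (fsf_star hY).
- rewrite wick_cons2 (starB hAE) (starM st) (starZ hAE) (fsf_star hY).
  rewrite !IH //; last exact: ltnW.
  rewrite !rev_cons wick_mulY conjc_nat addrK //.
Qed.

(** Of the two terms in [wick_rconsM], the first is a nonempty word, of mean zero, and the second
    falls under the induction hypothesis. Together with [star_wick], this says that the Wick words
    are orthonormal. *)
Lemma E_wick_revM u v : E (wick Y (rev u) * wick Y v) = (u == v)%:R.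
Proof.
elim: u v => [|i u IH] v; first by rewrite mul1r E_wick_eq eq_sym.
case: v => [|j v]; first by rewrite mulr1 E_wick_eq -size_eq0 size_rev.
rewrite rev_cons wick_rconsM linearD linearZ /= IH E_wick; last by case: (rev u).
by rewrite add0r eqseq_cons; case: (i == j); rewrite /= ?mul1r ?mul0r.
Qed.

End free_family.

(** * Wick sums and contractions *)

Section tuple_sums.
Variables (V : nmodType) (I : finType).
Implicit Types g : seq I -> V.

Lemma sum_tuple0 g : \sum_(w : 0.-tuple I) g w = g [::].
Proof.
rewrite (bigD1 [tuple]) //= big1 ?addr0 // => w.
by rewrite (tuple0 w); case/eqP.
Qed.

Lemma sum_tupleS n g :
  \sum_(w : n.+1.-tuple I) g w = \sum_(i : I) \sum_(w : n.-tuple I) g (i :: w).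
Proof.
rewrite pair_bigA /= (reindex (fun x : I * n.-tuple I => [tuple of x.1 :: x.2])) //=.
exists (fun w : n.+1.-tuple I => (thead w, [tuple of behead w])) => [[i w] _|w _].
  by rewrite theadE; congr (_, _); exact: val_inj.
by rewrite [RHS]tuple_eta.
Qed.

Lemma sum_tupleD m n g :
  \sum_(w : (m + n).-tuple I) g w =
  \sum_(u : m.-tuple I) \sum_(v : n.-tuple I) g (u ++ v).
Proof.
elim: m g => [|m IH] g; first by rewrite (sum_tuple0 (fun u => \sum_(v : n.-tuple I) g (u ++ v))).
rewrite addSn sum_tupleS (sum_tupleS _ (fun u => \sum_(v : n.-tuple I) g (u ++ v))).
by apply: eq_bigr => i _; exact: (IH (fun w => g (i :: w))).
Qed.

Lemma sum_tuple_rev n g : \sum_(w : n.-tuple I) g (rev w) = \sum_(w : n.-tuple I) g w.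
Proof.
rewrite [RHS](reindex (fun w : n.-tuple I => [tuple of rev w])) //=.
by exists (fun w : n.-tuple I => [tuple of rev w]) => w _; apply/val_inj; rewrite /= revK.
Qed.

Lemma sum_tuple_delta n (u : n.-tuple I) g :
  \sum_(w : n.-tuple I) g w *+ (u == w :> seq I) = g u.
Proof.
rewrite (bigD1 u) //= eqxx mulr1n big1 ?addr0 // => w wu.
by rewrite eq_sym -val_eqE in wu; rewrite (negPf wu) mulr0n.
Qed.

End tuple_sums.

(** By Lagrange's identity the defect is half of a double sum of squares. *)
Lemma sum_CS (R : realFieldType) (I : finType) (f g : I -> R) :
  (\sum_i f i * g i) ^+ 2 <= (\sum_i f i ^+ 2) * \sum_i g i ^+ 2.
Proof.
set F := \sum_i f i ^+ 2; set G := \sum_i g i ^+ 2; set H := \sum_i f i * g i.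
have key : 0 <= \sum_i \sum_j (f i * g j - f j * g i) ^+ 2.
  by apply: sumr_ge0 => i _; apply: sumr_ge0 => j _; exact: sqr_ge0.
suff E : \sum_i \sum_j (f i * g j - f j * g i) ^+ 2 = 2 * (F * G - H ^+ 2) by lra.
have e i j : (f i * g j - f j * g i) ^+ 2 =
    f i ^+ 2 * g j ^+ 2 + g i ^+ 2 * f j ^+ 2 - 2 * (f i * g i) * (f j * g j) by ring.
under eq_bigr => i _ do
  (under eq_bigr do rewrite e; rewrite sumrB big_split -!mulr_sumr -/F -/G -/H).
by rewrite sumrB big_split -!mulr_suml -mulr_sumr -/F -/G -/H /=; ring.
Qed.

Section wick_sums.
Local Open Scope complex_scope.
Variables (R : realType) (A : algType R[i]) (star : A -> A) (E : {scalar A}).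
Hypothesis hAE : is_Wstar_probability_space star E.
Variables (N : nat) (Y : 'I_N -> A).
Hypothesis hY : free_semicircular_family star E Y.
Notation word := (seq 'I_N).
Implicit Types (a b c : word -> R) (u v w x y z : word).

(* A kernel of degree [m] is the restriction of [a] to the words of length [m]. *)
Definition wick_sum m a : A := \sum_(w : m.-tuple 'I_N) (a w)%:C *: wick Y w.

Definition sqn m a : R := \sum_(w : m.-tuple 'I_N) a w ^+ 2.

Lemma sqn_ge0 m a : 0 <= sqn m a.
Proof. by apply: sumr_ge0 => w _; exact: sqr_ge0. Qed.

Lemma eq_wick_sum m a b : (forall w, size w = m -> a w = b w) ->
  wick_sum m a = wick_sum m b.
Proof. by move=> ab; apply: eq_bigr => w _; rewrite ab ?size_tuple. Qed.

Lemma eq_sqn m a b : (forall w, size w = m -> a w = b w) -> sqn m a = sqn m b.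
Proof. by move=> ab; apply: eq_bigr => w _; rewrite ab ?size_tuple. Qed.

Lemma wick_sumZ m (k : R) a : wick_sum m (fun w => k * a w) = k%:C *: wick_sum m a.
Proof.
by rewrite scaler_sumr; apply: eq_bigr => w _; rewrite scalerA rmorphM.
Qed.

Lemma sqnZ m (k : R) a : sqn m (fun w => k * a w) = k ^+ 2 * sqn m a.
Proof. by rewrite mulr_sumr; apply: eq_bigr => w _; rewrite exprMn. Qed.

Lemma star_wick_sum m a : star (wick_sum m a) = wick_sum m (a \o rev).
Proof.
rewrite (star_sum hAE) -[RHS](sum_tuple_rev m (fun w => (a (rev w))%:C *: wick Y w)).
apply: eq_bigr => w _.
by rewrite (starZ hAE) (star_wick hAE hY) conjc_real revK.
Qed.

Lemma E_wick_sumM m n a b : E (star (wick_sum m a) * wick_sum n b) =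
  (if m == n then \sum_(w : m.-tuple 'I_N) a w * b w else 0)%:C.
Proof.
rewrite (star_sum hAE) mulr_suml linear_sum /=.
case: eqP => [<-|mn]; last first.
  rewrite big1 // => u _; rewrite mulr_sumr linear_sum big1 // => v _.
  rewrite (starZ hAE) (star_wick hAE hY) -scalerAl -scalerAr !linearZ /=.
  rewrite (E_wick_revM hAE hY) (_ : (_ == _) = false) ?mulr0 ?scaler0 ?mulr0 //.
  by apply/eqP => uv; apply: mn; rewrite -(size_tuple u) -(size_tuple v) uv.
rewrite rmorph_sum; apply: eq_bigr => u _.
rewrite rmorphM -(sum_tuple_delta u (fun w => (a u)%:C * (b w)%:C)).
rewrite mulr_sumr linear_sum; apply: eq_bigr => v _.
rewrite (starZ hAE) conjc_real (star_wick hAE hY) -scalerAl -scalerAr !linearZ /=.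
by rewrite (E_wick_revM hAE hY) mulrA mulr_natr.
Qed.

(** Pythagoras: Wick sums of distinct degrees are orthogonal. *)
Lemma nrm_sum_wick (I : finType) (P : pred I) (d : I -> nat) (e : I -> word -> R) :
  {in P &, injective d} ->
  nrm star E (\sum_(i | P i) wick_sum (d i) (e i)) ^+ 2 = \sum_(i | P i) sqn (d i) (e i).
Proof.
move=> dI; apply: complexI; rewrite -(nrm_sq hAE) (star_sum hAE) mulr_suml linear_sum.
rewrite rmorph_sum; apply: eq_bigr => i Pi.
rewrite mulr_sumr linear_sum (bigD1 i) //= big1 ?addr0 => [|j /andP[Pj ji]].
  by rewrite E_wick_sumM eqxx; congr (_%:C); apply: eq_bigr => w _; rewrite expr2.
rewrite E_wick_sumM; case: eqP => // /dI ij.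
by rewrite ij ?eqxx in ji.
Qed.

Lemma nrm_wick_sum m a : nrm star E (wick_sum m a) ^+ 2 = sqn m a.
Proof.
have := @nrm_sum_wick 'I_1 predT (fun=> m) (fun=> a).
by rewrite !big_ord1 => -> // i j; rewrite !ord1.
Qed.

(* The [r]-th contraction of kernels of degrees [k + r] and [r + l]: the last [r]
   letters of the first one are paired, in reverse order, with the first [r]
   letters of the second one. *)
Definition contraction k r a b : word -> R := fun w =>
  \sum_(z : r.-tuple 'I_N) a (take k w ++ rev z) * b (z ++ drop k w).

Lemma wick_sumM p m a b : wick_sum p a * wick_sum m b =
  \sum_(r < (minn p m).+1) wick_sum ((p - r) + (m - r)) (contraction (p - r) r a b).
Proof.
rewrite {1}/wick_sum -(sum_tuple_rev _ (fun w => (a w)%:C *: wick Y w)) mulr_suml.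
transitivity (\sum_(u : p.-tuple 'I_N) \sum_(v : m.-tuple 'I_N)
   \sum_(r < (minn p m).+1) (a (rev u) * b v)%:C *:
     ((take r u == take r v)%:R *: wick Y (rev (drop r u) ++ drop r v))).
  apply: eq_bigr => u _; rewrite mulr_sumr; apply: eq_bigr => v _.
  rewrite -scalerAl -scalerAr scalerA -rmorphM wick_revM !size_tuple.
  by rewrite scaler_sumr.
under eq_bigr do rewrite exchange_big.
rewrite exchange_big; apply: eq_bigr => r _.
have rp : (r <= p)%N by have := ltn_ord r; rewrite ltnS leq_min => /andP[].
have rm : (r <= m)%N by have := ltn_ord r; rewrite ltnS leq_min => /andP[].
move: (nat_of_ord r) rp rm => {}r rp rm.
pose g u v := (a (rev u) * b v)%:C *:
     ((take r u == take r v)%:R *: wick Y (rev (drop r u) ++ drop r v)).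
(* Both words are cut after [r] letters. The coefficient forces their prefixes to agree, and the
   common prefix becomes the summation variable of the contraction. *)
transitivity (\sum_(u : (r + (p - r)).-tuple 'I_N) \sum_(v : (r + (m - r)).-tuple 'I_N) g u v).
  by rewrite !subnKC.
rewrite (sum_tupleD _ _ (fun u => \sum_(v : (r + (m - r)).-tuple 'I_N) g u v)).
rewrite exchange_big /=.
pose h u := (contraction (p - r) r a b u)%:C *: wick Y u.
rewrite [RHS](sum_tupleD _ _ h).
rewrite -(sum_tuple_rev _ (fun u => \sum_(v : (m - r).-tuple 'I_N) h (u ++ v))).
apply: eq_bigr => x _.
transitivity (\sum_(z : r.-tuple 'I_N) \sum_(y : (m - r).-tuple 'I_N) g (z ++ x) (z ++ y)).
  apply: eq_bigr => z _; rewrite (sum_tupleD _ _ (g (z ++ x))) exchange_big /=.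
  apply: eq_bigr => y _; rewrite -(sum_tuple_delta z (fun z' => g (z ++ x) (z' ++ y))).
  apply: eq_bigr => z' _; rewrite /g.
  rewrite !take_size_cat ?size_tuple // !drop_size_cat ?size_tuple //.
  by case: eqP => _; rewrite ?mulr1n // mulr0n scale0r scaler0.
rewrite exchange_big; apply: eq_bigr => y _; rewrite /h /contraction.
rewrite take_size_cat ?size_rev ?size_tuple // drop_size_cat ?size_rev ?size_tuple //.
rewrite rmorph_sum scaler_suml; apply: eq_bigr => z _; rewrite /g.
rewrite !take_size_cat ?size_tuple // !drop_size_cat ?size_tuple //.
by rewrite eqxx scale1r rev_cat.
Qed.

(** Cauchy-Schwarz in the contracted letters, for each choice [x], [y] of the remaining ones. *)
Lemma sqn_contraction k r l a b :
  sqn (k + l) (contraction k r a b) <= sqn (k + r) a * sqn (r + l) b.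
Proof.
rewrite /sqn (sum_tupleD _ _ (fun w => contraction k r a b w ^+ 2)).
rewrite (sum_tupleD _ _ (fun w => a w ^+ 2)) [X in _ * X](sum_tupleD _ _ (fun w => b w ^+ 2)).
rewrite mulr_suml; apply: ler_sum => x _.
rewrite exchange_big mulr_sumr; apply: ler_sum => y _; rewrite /contraction.
rewrite take_size_cat ?size_tuple // drop_size_cat ?size_tuple //.
rewrite -(sum_tuple_rev _ (fun z => a (x ++ z) ^+ 2)).
exact: (sum_CS (fun z : r.-tuple 'I_N => a (x ++ rev z)) (fun z : r.-tuple 'I_N => b (z ++ y))).
Qed.

End wick_sums.

(** * Haagerup's inequality and tensor powers *)

Section haagerup.
Local Open Scope complex_scope.
Variables (R : realType) (A : algType R[i]) (star : A -> A) (E : {scalar A}).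
Hypothesis hAE : is_Wstar_probability_space star E.
Variables (N : nat) (Y : 'I_N -> A).
Hypothesis hY : free_semicircular_family star E Y.
Notation word := (seq 'I_N).
Notation nrm := (nrm star E).
Implicit Types (a b c : word -> R) (w : word).

(* Unlike a bound on [nrm x], [wick_bound x M] is stable under multiplication by
   a Wick sum, because it remembers a homogeneous decomposition of [x]. *)
Inductive wick_bound : A -> R -> Prop :=
| WickBound0 : wick_bound 0 0
| WickBoundD x M m a : wick_bound x M ->
    wick_bound (wick_sum Y m a + x) (Num.sqrt (sqn m a) + M).

Lemma wick_bound_add x y M L :
  wick_bound x M -> wick_bound y L -> wick_bound (x + y) (M + L).
Proof.
move=> hx hy; elim: hx => [|x' M' m a _ IH]; first by rewrite !add0r.
by rewrite -!addrA; constructor.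
Qed.

Lemma wick_bound_sum n (d : 'I_n -> nat) (e : 'I_n -> word -> R) :
  wick_bound (\sum_i wick_sum Y (d i) (e i)) (\sum_i Num.sqrt (sqn (d i) (e i))).
Proof.
elim: n d e => [|n IH] d e; first by rewrite !big_ord0; constructor.
by rewrite !big_ord_recl; constructor; exact: IH.
Qed.

Lemma nrm_wick_bound x M : wick_bound x M -> nrm x <= M.
Proof.
elim=> [|{}x {}M m a _ IH]; first by rewrite (nrm0 hAE).
apply: le_trans (nrmD hAE _ _) _; apply: lerD => //.
by rewrite -(nrm_wick_sum hAE hY) sqrtr_sqr ler_norm.
Qed.

(** The product with a piece of degree [m] splits into [minn p m + 1] contractions, each controlled
    by [sqn_contraction]. The resulting factor [p.+1] does not depend on [m], which makes the bound
    iterable. *)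
Lemma wick_bound_mul p a x M : wick_bound x M -> exists2 L,
  wick_bound (wick_sum Y p a * x) L & L <= p.+1%:R * Num.sqrt (sqn p a) * M.
Proof.
elim=> [|{}x {}M m b _ [L hL ML]]; first by exists 0; rewrite !mulr0 //; constructor.
rewrite mulrDr wick_sumM mulrDr.
set S := \sum_(r < _) _; set B := \sum_(r < (minn p m).+1)
  Num.sqrt (sqn ((p - r) + (m - r)) (contraction (p - r) r a b)).
exists (B + L); first by apply: wick_bound_add => //; exact: wick_bound_sum.
apply: lerD => //.
apply: (@le_trans _ _ (\sum_(r < (minn p m).+1) Num.sqrt (sqn p a) * Num.sqrt (sqn m b))).
  apply: ler_sum => r _; rewrite -sqrtrM ?sqn_ge0 // ler_wsqrtr //.
  have rp : (r <= p)%N by have := ltn_ord r; rewrite ltnS leq_min => /andP[].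
  have rm : (r <= m)%N by have := ltn_ord r; rewrite ltnS leq_min => /andP[].
  by have := sqn_contraction (p - r) r (m - r) a b; rewrite subnK // subnKC.
rewrite sumr_const card_ord -[X in X <= _]mulr_natl mulrA.
by rewrite ler_wpM2r ?sqrtr_ge0 // ler_wpM2r ?sqrtr_ge0 // ler_nat ltnS geq_minl.
Qed.

(** [wick_bound_mul] is iterated from the unit, which is a Wick sum of degree 0. *)
Lemma haagerup p a k :
  nrm (wick_sum Y p a ^+ k) <= (p.+1%:R * Num.sqrt (sqn p a)) ^+ k.
Proof.
set c := _ * _; have c0 : 0 <= c by rewrite mulr_ge0 // sqrtr_ge0.
suff [M /nrm_wick_bound + Mk] : exists2 M, wick_bound (wick_sum Y p a ^+ k) M & M <= c ^+ k.
  by move=> h; exact: le_trans h Mk.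
elim: k => [|k [M hM Mk]].
  exists 1; rewrite // !expr0.
  have := WickBoundD 0 (fun=> 1) WickBound0; rewrite !addr0.
  rewrite /wick_sum (sum_tuple0 (fun w => 1%:C *: wick Y w)) rmorph1 scale1r.
  by rewrite /sqn (sum_tuple0 (fun w : word => 1 ^+ 2)) expr1n sqrtr1.
have [L hL Lc] := wick_bound_mul p a hM; exists L; first by rewrite exprS.
by apply: le_trans Lc _; rewrite exprS ler_wpM2l.
Qed.

End haagerup.

Section tensor_powers.
Local Open Scope complex_scope.
Variables (R : realType) (A : algType R[i]) (star : A -> A) (E : {scalar A}).

(* What the moments of a mirror symmetric Wick sum [G] of degree [p] with
   [E (G ^+ 2) = s] depend on: [B j] is the Wick sum of the [j]-th tensor power
   of its kernel, [D j] collects the nontrivial contractions and [eps] is the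
   sum of their squared norms. *)
Record quasi_semicircular (p : nat) (G : A) (s eps : R) (B D : nat -> A) : Prop := {
  qs_star : star G = G;
  qs_s : 0 <= s;
  qs_eps : 0 <= eps;
  qs_B0 : B 0%N = 1;
  qs_B1 : B 1%N = G;
  qs_EB : forall j, E (B j.+1) = 0;
  qs_rec : forall j, G * B j.+1 = B j.+2 + s%:C *: B j + D j;
  qs_D : forall j, nrm star E (D j) ^+ 2 = eps * s ^+ j;
  qs_2 : E (G ^+ 2) = s%:C;
  qs_4 : E (G ^+ 4) = (2 * s ^+ 2 + eps)%:C;
  qs_haagerup : forall k, nrm star E (G ^+ k) <= (p.+1%:R * Num.sqrt s) ^+ k }.

Hypothesis hAE : is_Wstar_probability_space star E.
Variables (N : nat) (Y : 'I_N -> A).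
Hypothesis hY : free_semicircular_family star E Y.
Notation word := (seq 'I_N).
Notation nrm := (nrm star E).
Implicit Types (a b c : word -> R) (w : word).

Definition tensor p a b : word -> R := fun w => a (take p w) * b (drop p w).

Lemma sqn_tensor p m a b : sqn (p + m) (tensor p a b) = sqn p a * sqn m b.
Proof.
rewrite /sqn (sum_tupleD _ _ (fun w => tensor p a b w ^+ 2)) mulr_suml.
apply: eq_bigr => u _; rewrite mulr_sumr; apply: eq_bigr => v _.
by rewrite /tensor take_size_cat ?size_tuple // drop_size_cat ?size_tuple // exprMn.
Qed.

Lemma contraction0 p a b : contraction p 0 a b =1 tensor p a b.
Proof.
move=> w; rewrite /contraction (sum_tuple0 (fun z => a (take p w ++ rev z) * b (z ++ drop p w))).
by rewrite cats0.
Qed.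

(** All [r] contracted letters lie in the first tensor factor, of degree [r + k], so [b] stays
    untouched. *)
Lemma contraction_tensor k r a b w : contraction k r a (tensor (r + k) a b) w =
  tensor (k + k) (contraction k r a a) b w.
Proof.
rewrite /contraction /tensor mulr_suml; apply: eq_bigr => z _.
rewrite mulrA take_cat drop_cat size_tuple ltnNge leq_addr /= addKn.
by rewrite drop_drop take_takel ?leq_addl // take_drop.
Qed.

Variables (p : nat) (a : word -> R).
Hypothesis arev : forall w, size w = p.+1 -> a (rev w) = a w.
Let q := p.+1.
Let s := sqn q a.
Let G := wick_sum Y q a.

Fixpoint tpow j : word -> R :=
  if j is j1.+1 then tensor q a (tpow j1) else fun=> 1.

Lemma sqn_tpow j : sqn (j * q) (tpow j) = s ^+ j.
Proof.
elim: j => [|j IH]; last by rewrite mulSn sqn_tensor IH exprS.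
by rewrite /sqn (sum_tuple0 (fun w => 1 ^+ 2)) expr1n.
Qed.

(** Mirror symmetry undoes the reversal in the pairing, so that contracting [a] with itself yields
    its squared norm. *)
Lemma full_contraction b w : contraction 0 q a (tensor q a b) w = s * b w.
Proof.
rewrite /contraction /s /sqn mulr_suml; apply: eq_bigr => z _.
rewrite take0 drop0 /tensor arev ?size_tuple // take_size_cat ?size_tuple //.
by rewrite drop_size_cat ?size_tuple // expr2 mulrA.
Qed.

Let inner (r : nat) : word -> R := contraction (q - r) r a a.

(** The degree is [q = p.+1], so the index [r < p], shifted by one, runs through the contraction
    orders [1, ..., q - 1]. *)
Definition tpow_error (j : nat) : A :=
  \sum_(r < p) wick_sum Y ((q - r.+1) + (j.+1 * q - r.+1))
     (tensor ((q - r.+1) + (q - r.+1)) (inner r.+1) (tpow j)).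

Lemma mul_tpow j : G * wick_sum Y (j.+1 * q) (tpow j.+1) =
  wick_sum Y (j.+2 * q) (tpow j.+2) + s%:C *: wick_sum Y (j * q) (tpow j)
  + tpow_error j.
Proof.
(* Order 0 gives the next tensor power and order [q] a multiple of the previous one; the orders in
   between form the error. *)
rewrite wick_sumM (minn_idPl _) ?leq_pmull // big_ord_recl big_ord_recr /=.
rewrite addrAC -addrA; congr (_ + (_ + _)).
- rewrite !subn0 [in RHS]mulSn; apply: eq_wick_sum => w _; exact: contraction0.
- apply: eq_bigr => r _; rewrite /bump /= add1n; apply: eq_wick_sum => w _.
  have rq : (r.+1 <= q)%N by rewrite ltnS ltnW.
  by rewrite -contraction_tensor subnKC.
- rewrite /bump /= add1n subnn add0n mulSn addKn -wick_sumZ.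
  by apply: eq_wick_sum => w _; exact: full_contraction.
Qed.

Let eps := \sum_(r < p) sqn ((q - r.+1) + (q - r.+1)) (inner r.+1).

(** Different contraction orders give different degrees, hence orthogonal terms, and [sqn] is
    multiplicative on tensor products. *)
Lemma nrm_tpow_error j : nrm (tpow_error j) ^+ 2 = eps * s ^+ j.
Proof.
rewrite (nrm_sum_wick hAE hY (P := predT) (fun r : 'I_p => _)); last first.
  move=> r r' _ _ rr'; apply/val_inj => /=; move: (ltn_ord r) (ltn_ord r') rr'.
  by rewrite mulSn /q; lia.
rewrite mulr_suml; apply: eq_bigr => r _; rewrite -sqn_tpow -sqn_tensor.
congr sqn; move: (ltn_ord r); rewrite mulSn /q; lia.
Qed.

Lemma wick_sum_quasi_semicircular :
  quasi_semicircular q G s eps (fun j => wick_sum Y (j * q) (tpow j)) tpow_error.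
Proof.
have starG : star G = G.
  by rewrite (star_wick_sum hAE hY); apply: eq_wick_sum => w /arev.
have B1 : wick_sum Y (1 * q) (tpow 1) = G.
  rewrite mul1n; apply: eq_wick_sum => w sw.
  by rewrite /= /tensor mulr1 take_oversize // sw.
have B0 : wick_sum Y (0 * q) (tpow 0) = 1.
  by rewrite /wick_sum (sum_tuple0 (fun w => 1%:C *: wick Y w)) rmorph1 scale1r.
split => //.
- exact: sqn_ge0.
- by apply: sumr_ge0 => r _; exact: sqn_ge0.
- move=> j; have := E_wick_sumM hAE hY 0 (j.+1 * q) (tpow 0) (tpow j.+1).
  by rewrite -[in star _](mul0n q) B0 (star1 hAE) mul1r.
- exact: mul_tpow.
- exact: nrm_tpow_error.
- by rewrite expr2 -{1}starG (nrm_sq hAE) (nrm_wick_sum hAE hY).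
(* The fourth moment is the squared norm of [G ^+ 2]. Its contractions of orders 0 and [q]
   contribute [s ^+ 2] each, the others [eps]. *)
- have -> : G ^+ 4 = star (G ^+ 2) * G ^+ 2.
    by rewrite (starX hAE) starG -exprD.
  rewrite (nrm_sq hAE) (expr2 G) /G wick_sumM minnn; congr (_%:C).
  rewrite (nrm_sum_wick hAE hY (P := predT) (fun r : 'I_q.+1 => _)); last first.
    move=> r r' _ _ rr'; apply/val_inj => /=; move: (ltn_ord r) (ltn_ord r') rr'.
    by rewrite /q; lia.
  rewrite big_ord_recl big_ord_recr /= -/q.
  rewrite !subn0 (eq_sqn (b := tensor q a a)); last by move=> w _; exact: contraction0.
  rewrite sqn_tensor -/s /bump /= !add1n subnn.
  have -> : sqn (0 + 0) (contraction 0 q a a) = s ^+ 2.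
    rewrite /sqn (sum_tuple0 (fun w => contraction 0 q a a w ^+ 2)); congr (_ ^+ 2).
    by apply: eq_bigr => z _; rewrite cats0 arev ?size_tuple // expr2.
  by under eq_bigr do rewrite add1n; rewrite -/eps; ring.
- exact: haagerup.
Qed.

End tensor_powers.

Lemma mirror_wick_sum_quasi_semicircular (R : realType) (A : algType R[i])
    (star : A -> A) (E : {scalar A}) (N : nat) (Y : 'I_N -> A) (p : nat)
    (a : seq 'I_N -> R) :
  is_Wstar_probability_space star E -> free_semicircular_family star E Y ->
  (0 < p)%N -> (forall w, size w = p -> a (rev w) = a w) ->
  exists s eps B D, quasi_semicircular star E p (wick_sum Y p a) s eps B D.
Proof.
case: p => // p hAE hY _ arev.
by do 4 eexists; exact: wick_sum_quasi_semicircular.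
Qed.

(** * Convergence of the moments *)

Section limits.
Local Open Scope complex_scope.
Variables (R : realType).

Lemma normrE (z : R[i]) : `|z| = (normc z)%:C.
Proof. by rewrite normc_def; case: z. Qed.

Lemma complex_gt0 (e : R[i]) : 0 < e -> exists2 r : R, 0 < r & e = r%:C.
Proof.
rewrite ltcE /= => /andP[/eqP e0 er]; exists (complex.Re e) => //.
by move: e0; case: e {er} => u v /= ->.
Qed.

Definition ctends (x : nat -> R[i]) (l : R[i]) : Prop :=
  x n @[n --> \oo] --> (l : R[i]^o).

Lemma ctends_cst (l : R[i]) : ctends (fun=> l) l.
Proof. exact: (@cvg_cst (R[i]^o)%type). Qed.

Lemma ctendsD x y l m : ctends x l -> ctends y m -> ctends (fun n => x n + y n) (l + m).
Proof. exact: (@cvgD R[i] (R[i]^o)%type nat \oo _ x y). Qed.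

Lemma ctendsM x y l m : ctends x l -> ctends y m -> ctends (fun n => x n * y n) (l * m).
Proof. exact: (@cvgM R[i] nat \oo _ x y). Qed.

Lemma ctendsX x l k : ctends x l -> ctends (fun n => x n ^+ k) (l ^+ k).
Proof.
move=> xl; elim: k => [|k IH]; first exact: ctends_cst.
rewrite exprS (_ : (fun n => _) = (fun n => x n * x n ^+ k)); first exact: ctendsM.
by apply/funext => n; rewrite exprS.
Qed.

Lemma ctends0_sqr_le (x : nat -> R[i]) (y : nat -> R) :
  (forall n, normc (x n) ^+ 2 <= y n) -> ctends (fun n => (y n)%:C) 0 ->
  ctends x 0.
Proof.
move=> xy /(@cvgr0Pnorm_lt _ (R[i]^o)%type) h.
apply/(@cvgr0Pnorm_lt _ (R[i]^o)%type) => e /complex_gt0[r r0 ->].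
have r2 : 0 < (r ^+ 2)%:C by rewrite ltcR exprn_gt0.
near=> n; rewrite normrE ltcR -(@ltr_pXn2r _ 2) ?nnegrE ?normc_ge0 ?(ltW r0) //.
apply: le_lt_trans (xy n) _; apply: le_lt_trans (ler_norm _) _.
have : `|(y n)%:C| < (r ^+ 2)%:C by near: n; exact: h.
by rewrite normrE ltcR /= expr0n addr0 sqrtr_sqr.
Unshelve. all: end_near. Qed.

End limits.
Arguments ctends_cst : clear implicits.
Arguments ctends_cst {R}.
Arguments ctendsX {R x l} k _.

Section fourth_moment.
Local Open Scope complex_scope.
Variables (R : realType) (A : algType R[i]) (star : A -> A) (E : {scalar A}).
Hypothesis hAE : is_Wstar_probability_space star E.
Notation nrm := (nrm star E).

Variable X : A.
Hypothesis hX : forall j, E (horner_alg X (chebyshev _ j.+1)) = 0.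

Lemma chebyshev_moment2 : E (X ^+ 2) = 1.
Proof.
have := hX 1; rewrite /= rmorphB rmorphM rmorph1 /= horner_algX -expr2 linearB /=.
by rewrite (ncps_unit hAE) => /eqP; rewrite subr_eq0 => /eqP.
Qed.

Lemma chebyshev_moment4 : E (X ^+ 4) = 2.
Proof.
have := hX 3; rewrite /= !(rmorphB, rmorphM, rmorph1) /= !horner_algX.
rewrite !mulrBr !mulr1 -!expr2 -!exprS !linearB /= chebyshev_moment2 (ncps_unit hAE).
(* The bracket is the expectation of the fourth Chebyshev polynomial, X^4 - 3 X^2 + 1, with second
   moment 1 inserted. *)
set e := E _ => h; have -> : 2 = e - (e - 1 - 1 + (-1 - -1)) by ring.
rewrite h subr0; reflexivity.
Qed.

Variables (p : nat) (G : nat -> A) (s eps : nat -> R) (B D : nat -> nat -> A).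
Hypothesis hG : forall n, quasi_semicircular star E p (G n) (s n) (eps n) (B n) (D n).
Hypothesis hG2 : ctends (fun n => E (G n ^+ 2)) 1.
Hypothesis hG4 : ctends (fun n => E (G n ^+ 4)) 2.

Let s_cvg : ctends (fun n => (s n)%:C) 1.
Proof.
rewrite (_ : (fun n => _) = (fun n => E (G n ^+ 2))) //.
by apply/funext => n; rewrite (qs_2 (hG n)).
Qed.

Let eps_cvg : ctends (fun n => (eps n)%:C) 0.
Proof.
have := ctendsD hG4 (ctendsM (ctends_cst (- 2)) (ctendsM s_cvg s_cvg)).
rewrite !mulr1 subrr; congr ctends; apply/funext => n.
rewrite (qs_4 (hG n)) expr2 rmorphD !rmorphM rmorph_nat.
by rewrite mulNr addrAC subrr add0r.
Qed.

(** Cauchy-Schwarz separates the two factors: Haagerup's inequality keeps the first bounded, and the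
    second has squared norm [eps n * s n ^+ j], which tends to 0. *)
Let error_cvg k j : ctends (fun n => E (G n ^+ k * D n j)) 0.
Proof.
apply: (@ctends0_sqr_le _ _ (fun n => (p.+1%:R ^+ 2 * s n) ^+ k * (eps n * s n ^+ j))).
  move=> n; apply: (@le_trans _ _ ((nrm (G n ^+ k) * nrm (D n j)) ^+ 2)).
    by rewrite ler_pXn2r ?nnegrE ?mulr_ge0 ?nrm_ge0 ?normc_ge0 //; exact: nrm_CSM.
  rewrite exprMn (qs_D (hG n)) ler_wpM2r ?mulr_ge0 ?exprn_ge0 ?(qs_s (hG n)) ?(qs_eps (hG n)) //.
  apply: (@le_trans _ _ (((p.+1%:R * Num.sqrt (s n)) ^+ k) ^+ 2)).
    rewrite ler_pXn2r ?nnegrE ?nrm_ge0 ?exprn_ge0 ?mulr_ge0 ?sqrtr_ge0 //.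
    exact: (qs_haagerup (hG n)).
  by rewrite exprAC [(_ * _) ^+ 2]exprMn sqr_sqrtr // (qs_s (hG n)).
have := ctendsM (ctendsX k (ctendsM (ctends_cst (p.+1%:R ^+ 2)) s_cvg))
                (ctendsM eps_cvg (ctendsX j s_cvg)).
rewrite mul0r mulr0; congr ctends; apply/funext => n.
by rewrite rmorphM rmorphXn rmorphM rmorphXn rmorph_nat rmorphM rmorphXn.
Qed.

(** Induction on [k] for all [j] at once: one factor [G n] is traded for the indices [j.+1] and
    [j.-1], exactly as [X] acts on Chebyshev polynomials. *)
Lemma fourth_moment_chebyshev k j :
  ctends (fun n => E (G n ^+ k * B n j)) (E (X ^+ k * horner_alg X (chebyshev _ j))).
Proof.
elim: k j => [|k IH] [|j].
- rewrite expr0 mul1r /= rmorph1 (_ : (fun n => _) = fun=> E 1); first exact: ctends_cst.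
  by apply/funext => n; rewrite expr0 mul1r (qs_B0 (hG _)).
- rewrite expr0 mul1r hX (_ : (fun n => _) = fun=> 0); first exact: ctends_cst.
  by apply/funext => n; rewrite expr0 mul1r (qs_EB (hG _)).
- have := IH 1%N; rewrite /= horner_algX -exprSr rmorph1 mulr1; congr ctends.
  by apply/funext => n; rewrite (qs_B0 (hG n)) (qs_B1 (hG n)) mulr1 exprSr.
- have := ctendsD (ctendsD (IH j.+2) (ctendsM s_cvg (IH j))) (error_cvg k j).
  congr ctends.
    apply/funext => n; rewrite exprSr -mulrA (qs_rec (hG n)) !mulrDr -scalerAr.
    by rewrite !linearD linearZ /=.
  rewrite addr0 mul1r -linearD -mulrDr -rmorphD /= subrK rmorphM /= horner_algX.
  by rewrite mulrA -exprSr.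
Qed.

Lemma fourth_moment_quasi_semicircular k :
  ctends (fun n => E (G n ^+ k)) (E (X ^+ k)).
Proof.
have := @fourth_moment_chebyshev k 0%N; rewrite /= rmorph1 mulr1; congr ctends.
by apply/funext => n; rewrite (qs_B0 (hG _)) mulr1.
Qed.

End fourth_moment.

(** * Stability of the moments under L2 approximation *)

Section approximation.
Local Open Scope complex_scope.
Variables (R : realType) (A : algType R[i]) (star : A -> A) (E : {scalar A}).
Hypothesis hAE : is_Wstar_probability_space star E.
Notation nrm := (nrm star E).
Variable p : nat.

Let starM' a b : star (a * b) = star b * star a.
Proof. by apply: starM; have [[]] := hAE. Qed.

Lemma nrm_quasi_semicircular G s eps B D :
  quasi_semicircular star E p G s eps B D -> nrm G = Num.sqrt s.
Proof.
move=> hG; have := qs_2 hG; rewrite expr2 -{1}(qs_star hG) (nrm_sq hAE) => /complexI <-.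
by rewrite sqrtr_sqr ger0_norm // nrm_ge0.
Qed.

(** The factors [F] are replaced by [G] one at a time. The constant may depend on [F], but must be
    uniform in [G]. *)
Lemma moment_diff_le F k l : exists2 C : R, 0 <= C &
  forall G s eps B D, quasi_semicircular star E p G s eps B D -> nrm (F - G) <= 1 ->
  normc (E (G ^+ l * F ^+ k) - E (G ^+ (l + k))) <= C * nrm (F - G).
Proof.
elim: k l => [|k IH] l.
  exists 0 => // G s eps B D _ _.
  by rewrite expr0 mulr1 addn0 subrr normc0 mul0r.
have [C C0 hC] := IH l.+1.
(* [K] bounds [nrm (F ^+ k * G ^+ l)]: traciality and Cauchy-Schwarz bound its square by the norm of
   [G ^+ (l + l)] times that of [star (F ^+ k) * F ^+ k]. Haagerup's inequality and
   [nrm G <= nrm F + 1] then control the former. *)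
pose K := Num.sqrt ((p.+1%:R * (nrm F + 1)) ^+ (l + l) * nrm (star (F ^+ k) * F ^+ k)).
exists (K + C) => [|G s eps B D hG FG]; first by rewrite addr_ge0 // sqrtr_ge0.
have -> : E (G ^+ l * F ^+ k.+1) - E (G ^+ (l + k.+1)) =
    E (G ^+ l * (F - G) * F ^+ k) + (E (G ^+ l.+1 * F ^+ k) - E (G ^+ (l.+1 + k))).
  rewrite addrA -linearD; congr (E _ - E (G ^+ _)); last by rewrite addSnnS.
  by rewrite exprS mulrA [G ^+ l.+1]exprSr -mulrDl -mulrDr subrK.
apply: le_trans (le_normcD _ _) _; rewrite mulrDl lerD ?(hC _ _ _ _ _ hG) //.
rewrite -mulrA (ncps_tracial hAE) -mulrA mulrC.
apply: le_trans (nrm_CSM hAE _ _) _; rewrite ler_wpM2l ?nrm_ge0 //.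
rewrite -(@ler_pXn2r _ 2) ?nnegrE ?nrm_ge0 ?sqrtr_ge0 // [X in _ <= X]sqr_sqrtr; last first.
  by rewrite mulr_ge0 ?exprn_ge0 ?mulr_ge0 ?addr_ge0 ?nrm_ge0.
have -> : nrm (F ^+ k * G ^+ l) ^+ 2 = normc (E (G ^+ (l + l) * (star (F ^+ k) * F ^+ k))).
  have <- : (nrm (F ^+ k * G ^+ l) ^+ 2)%:C = E (G ^+ (l + l) * (star (F ^+ k) * F ^+ k)).
    rewrite -(nrm_sq hAE) starM' (starX hAE G) (qs_star hG) exprD.
    by rewrite mulrA (ncps_tracial hAE) !mulrA.
  by rewrite /= expr0n addr0 sqrtr_sqr ger0_norm // sqr_ge0.
apply: le_trans (nrm_CSM hAE _ _) _; rewrite ler_wpM2r ?nrm_ge0 //.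
apply: le_trans (qs_haagerup hG _) _.
rewrite lerXn2r ?nnegrE ?mulr_ge0 ?sqrtr_ge0 ?addr_ge0 ?nrm_ge0 //.
rewrite ler_wpM2l // -(nrm_quasi_semicircular hG).
have -> : G = F + - (F - G) by rewrite opprB addrC subrK.
by apply: le_trans (nrmD hAE _ _) _; rewrite (nrmN hAE) lerD2l.
Qed.

Definition approximable F := forall d : R, 0 < d -> exists G s eps B D,
  quasi_semicircular star E p G s eps B D /\ nrm (F - G) <= d.

Lemma approximate_moments F K e : approximable F -> 0 < e ->
  exists G s eps B D, quasi_semicircular star E p G s eps B D /\
    forall k, (k < K)%N -> normc (E (F ^+ k) - E (G ^+ k)) <= e.
Proof.
move=> hF e0; elim: K => [|K _].
  have [G [s [eps [B [D [hG _]]]]]] := hF 1 ltr01.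
  by exists G, s, eps, B, D.
have /choice[C hC] : forall k, exists C : R, 0 <= C /\
  forall G s eps B D, quasi_semicircular star E p G s eps B D -> nrm (F - G) <= 1 ->
  normc (E (F ^+ k) - E (G ^+ k)) <= C * nrm (F - G).
  move=> k; have [C C0 h] := moment_diff_le F k 0; exists C; split => // G s eps B D hG FG.
  by have := h _ _ _ _ _ hG FG; rewrite mul1r.
(* [c] dominates the finitely many constants [C k], and is at least 1 so that [e / c] makes
   sense. *)
pose c := 1 + \sum_(k < K.+1) C k.
have c1 : 1 <= c by rewrite lerDl sumr_ge0 // => k _; have [] := hC k.
have d0 : 0 < Num.min 1 (e / c) by rewrite lt_min ltr01 divr_gt0 // (lt_le_trans ltr01).
have [G [s [eps [B [D [hG]]]]]] := hF _ d0.
rewrite le_min => /andP[FG1 FGe]; exists G, s, eps, B, D; split => // k kK.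
have [Ck h] := hC k; apply: le_trans (h _ _ _ _ _ hG FG1) _.
rewrite ler_pdivlMr ?(lt_le_trans ltr01) // in FGe.
apply: le_trans FGe; rewrite mulrC ler_wpM2l ?nrm_ge0 // /c (bigD1 (Ordinal kK)) //=.
rewrite addrCA lerDl addr_ge0 // sumr_ge0 // => i _; by have [] := hC i.
Qed.

Variable X : A.
Hypothesis hX : forall j, E (horner_alg X (chebyshev _ j.+1)) = 0.

(** A diagonal choice: the approximant of [F n] matches its moments up to order [n + 4] within
    [1 / (n + 1)]. For each fixed order the two moment sequences thus have the same limit. *)
Lemma fourth_moment_approximable (F : nat -> A) : (forall n, approximable (F n)) ->
  ctends (fun n => E (F n ^+ 2)) 1 -> ctends (fun n => E (F n ^+ 4)) 2 ->
  forall k, ctends (fun n => E (F n ^+ k)) (E (X ^+ k)).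
Proof.
move=> hF F2 F4.
have /choice[g hg] : forall n, exists g : A * R * R * (nat -> A) * (nat -> A),
    let: (G, s, eps, B, D) := g in quasi_semicircular star E p G s eps B D /\
    forall k, (k < n.+4.+1)%N -> normc (E (F n ^+ k) - E (G ^+ k)) <= n.+1%:R^-1.
  move=> n; have [|G [s [eps [B [D h]]]]] := @approximate_moments (F n) n.+4.+1 n.+1%:R^-1 (hF n).
    by rewrite invr_gt0.
  by exists (G, s, eps, B, D).
pose G n := let: (G, s, eps, B, D) := g n in G.
have FG k : ctends (fun n => E (F n ^+ k) - E (G n ^+ k)) 0.
  apply/(@cvgr0Pnorm_lt _ (R[i]^o)%type) => e /complex_gt0[r r0 ->].
  have nr := near_infty_natSinv_lt (PosNum r0).
  near=> n; rewrite normrE ltcR /G.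
  move: (hg n); case: (g n) => -[[[H s] eps] B] D [_ h].
  apply: le_lt_trans (h k _) _.
    by rewrite ltnS (@leq_trans n) ?leq_addr //; [near: n; exact: nbhs_infty_ge | lia].
  near: n; exact: nr.
have GE k : (fun n => E (G n ^+ k)) =
    (fun n => E (F n ^+ k) + (-1) * (E (F n ^+ k) - E (G n ^+ k))).
  by apply/funext => n; rewrite mulN1r opprB addrC subrK.
have Gc k l : ctends (fun n => E (F n ^+ k)) l -> ctends (fun n => E (G n ^+ k)) l.
  by move=> h; have := ctendsD h (ctendsM (ctends_cst (-1)) (FG k)); rewrite -GE mulr0 addr0.
have key k : ctends (fun n => E (G n ^+ k)) (E (X ^+ k)).
  apply: (@fourth_moment_quasi_semicircular _ _ _ _ hAE X hX p G
    (fun n => (g n).1.1.1.2) (fun n => (g n).1.1.2) (fun n => (g n).1.2)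
    (fun n => (g n).2)); [|exact: Gc|exact: Gc].
  by move=> n; rewrite /G; move: (hg n); case: (g n) => -[[[H s] eps] B] D [].
move=> k; have := ctendsD (key k) (FG k); rewrite addr0; congr ctends.
by apply/funext => n; rewrite addrC subrK.
Unshelve. all: end_near. Qed.

End approximation.

(** * Semicircular moments *)

Section chebyshev_ode.
Variable K : numFieldType.
Notation U := (chebyshev K).

Lemma chebyshevSS n : U n.+2 = 'X * U n.+1 - U n.
Proof. by []. Qed.

(** The two relations support each other in the induction. Their doubled forms are proved, since [h]
    expresses twice the derivative of [U n.+2]. *)
Lemma chebyshev_deriv n :
  (4 - 'X ^+ 2) * (U n.+1)^`() = - n.+1%:R * 'X * U n.+1 + 2 * n.+2%:R * U n /\
  'X * (U n.+1)^`() - 2 * (U n)^`() = n.+1%:R * U n.+1.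
Proof.
elim: n => [|n [a b]].
  by rewrite /= derivX -[1]/(1%:P) derivC; split; ring.
have h : 2 * (U n.+2)^`() = n.+3%:R * U n.+1 + 'X * (U n.+1)^`().
  rewrite chebyshevSS derivB derivM derivX mul1r -[LHS]subr0 -(subrr (n.+1%:R * U n.+1)).
  by rewrite -{1}b; ring.
have two0 : (2 : {poly K}) != 0 by rewrite -polyC_natr polyC_eq0 pnatr_eq0.
split; apply: (mulfI two0).
  transitivity ((4 - 'X ^+ 2) * (2 * (U n.+2)^`())); first by ring.
  rewrite h mulrDr [X in _ + X]mulrCA a chebyshevSS; ring.
transitivity ('X * (2 * (U n.+2)^`()) - 4 * (U n.+1)^`()); first by ring.
rewrite h; transitivity (n.+3%:R * 'X * U n.+1 - (4 - 'X ^+ 2) * (U n.+1)^`()); first by ring.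
by rewrite a chebyshevSS; ring.
Qed.

(** Differentiate the first relation of [chebyshev_deriv] and eliminate the derivative of [U n] by
    the second. *)
Lemma chebyshev_ode n :
  (4 - 'X ^+ 2) * (U n.+1)^`()^`() - 3 * 'X * (U n.+1)^`() =
  - (n.+1%:R * n.+3%:R) * U n.+1.
Proof.
have [a b] := chebyshev_deriv n.
have dn k : (k%:R : {poly K})^`() = 0 by rewrite -polyC_natr derivC.
move: (U n.+1) (U n) a b => u v a /eqP; rewrite -subr_eq0 => /eqP b.
have /eqP := congr1 (@deriv K) a; rewrite -subr_eq0 => /eqP.
rewrite derivD !derivM derivB derivXn derivN derivX !dn => h.
have lin (x y z t c : {poly K}) : z = 0 -> t = 0 -> x - y = z - c * t -> x = y.
  by move=> -> ->; rewrite mulr0 subr0 => /eqP; rewrite subr_eq0 => /eqP.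
by apply: (lin _ _ _ _ n.+2%:R h b); ring.
Qed.

End chebyshev_ode.
Section semicircle_moments.
Variable R : realType.
Local Notation mu := lebesgue_measure.
Local Notation m := (semicircle_moment R).
Let c : R := (2 * pi)^-1.

Let integrand (k : nat) (x : R) : R := x ^+ k * (Num.sqrt (4 - x ^+ 2) / (2 * pi)).

Let continuous_sqrt4 : continuous (fun x : R => Num.sqrt (4 - x ^+ 2)).
Proof.
move=> x; apply: (@continuous_comp _ _ _ (fun x : R => 4 - x ^+ 2) Num.sqrt).
  by apply: cvgB; [exact: cvg_cst | exact: exprn_continuous].
exact: sqrt_continuous.
Qed.

Let continuous_integrand k : continuous (integrand k).
Proof.
move=> x; apply: cvgM; first exact: exprn_continuous.
by apply: cvgM; [exact: continuous_sqrt4 | exact: cvg_cst].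
Qed.

Let integrable_integrand k : mu.-integrable `[-2, 2]%classic (EFin \o integrand k).
Proof.
apply: continuous_compact_integrable; first exact: segment_compact.
by apply: continuous_subspaceT => x; exact: continuous_integrand.
Qed.

(* Integration by parts: the integrand is the derivative of
   [x ^+ j * (4 - x ^+ 2) ^ (3/2) / (2 * pi)]. *)
Lemma semicircle_moment_rec j : 4 * j%:R * m j.-1 - j.+3%:R * m j.+1 = 0.
Proof.
(* For [j = 0] the index [j.-1] is 0, but its coefficient vanishes. *)
pose f x := 4 * j%:R * integrand j.-1 x - j.+3%:R * integrand j.+1 x.
pose F (x : R) := (x ^+ j * (4 - x ^+ 2)) * (Num.sqrt (4 - x ^+ 2) * c).
have intZ a k : mu.-integrable `[-2, 2]%classic (EFin \o (fun x => a * integrand k x)).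
  by apply: eq_integrable (integrableZl _ a (integrable_integrand k)).
have -> : 4 * j%:R * m j.-1 - j.+3%:R * m j.+1 = \int[mu]_(x in `[-2, 2]%classic) f x.
  by rewrite RintegralB // !RintegralZl.
have cF : continuous F.
  move=> x; apply: cvgM; last first.
    by apply: cvgM; [exact: continuous_sqrt4 | exact: cvg_cst].
  apply: cvgM; first exact: exprn_continuous.
  by apply: cvgB; [exact: cvg_cst | exact: exprn_continuous].
(* The formula is computed where the square root is differentiable; at the end points, continuity of
   [F] suffices for the fundamental theorem. *)
have dF (x : R) : x \in `]-2, 2[ -> is_derive x 1 F (f x).
  rewrite in_itv /= => /andP[x1 x2].
  have S2 : 0 < 4 - x ^+ 2 by nra.
  have d1 : is_derive x 1 (fun y : R => 4 - y ^+ 2) (- (2 * x)).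
    by apply: is_derive_eq; rewrite /GRing.scale /= mulr1; ring.
  have d2 : is_derive x 1 (fun y : R => Num.sqrt (4 - y ^+ 2))
      ((2 * Num.sqrt (4 - x ^+ 2))^-1 * - (2 * x)).
    have ds := is_derive1_sqrt S2; exact: is_derive1_comp.
  have dX : is_derive x 1 (fun y : R => y ^+ j) (j%:R * x ^+ j.-1).
    by split; [exact: exprn_derivable | rewrite exp_derive /GRing.scale /= mulr1].
  have := is_deriveM (is_deriveM dX d1) (is_deriveM d2 (is_derive_cst c x 1)).
  move/is_derive_eq; apply; rewrite /GRing.scale /= !fctE mulr0 add0r /f /integrand -/c.
  have Sn0 : Num.sqrt (4 - x ^+ 2) != 0 by rewrite gt_eqF ?sqrtr_gt0.
  have SS : 4 - x ^+ 2 = Num.sqrt (4 - x ^+ 2) ^+ 2 by rewrite sqr_sqrtr // ltW.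
  have e : (4 - x ^+ 2) * (2 * Num.sqrt (4 - x ^+ 2))^-1 = Num.sqrt (4 - x ^+ 2) / 2.
    by rewrite {1}SS; field.
  move: (Num.sqrt _) (_^-1) e {SS Sn0 d2 S2} => S r e.
  transitivity (- 2 * x * x ^+ j * c * ((4 - x ^+ 2) * r)
    + S * c * (x ^+ j * - (2 * x) + (4 - x ^+ 2) * (j%:R * x ^+ j.-1))); first by ring.
  rewrite e; case: j {dX F cF f} => [|k] /=; first by field.
  by rewrite !exprS; field.
have /(congr1 fine) : (\int[mu]_(x in `[(-2)%R, 2%R]%classic) (f x)%:E =
    (F 2%R)%:E - (F (-2)%R)%:E)%E.
  apply: continuous_FTC2.
  - lra.
  - apply: continuous_subspaceT => y; apply: cvgB.
      by apply: cvgM; [exact: cvg_cst | exact: continuous_integrand].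
    by apply: cvgM; [exact: cvg_cst | exact: continuous_integrand].
  - split => [y /dF[]//||]; apply: cvg_within_filter; exact: cF.
  - by move=> y /dF dFy; rewrite derive1E derive_val.
rewrite /Rintegral => ->.
have z : 4 - 2 ^+ 2 = 0 :> R by ring.
by rewrite /F sqrrN z !mulr0 !mul0r -EFinB /= subrr.
Qed.

End semicircle_moments.

Section semicircular_chebyshev.
Local Open Scope complex_scope.
Variables (R : realType) (A : algType R[i]) (E : {scalar A}) (X : A).
Hypothesis EX : forall k, E (X ^+ k) = (semicircle_moment R k)%:C.

(* With the differential equation of [U_n], which expresses [U_n] through its
   derivative, the moment recursion for [q = U_n'] gives [E (U_n X) = 0]. *)
Let E_ode (q : {poly R[i]}) :
  E (horner_alg X ((4 - 'X ^+ 2) * q^`() - 3 * 'X * q)) = 0.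
Proof.
pose phi (q : {poly R[i]}) := (4 - 'X ^+ 2) * q^`() - 3 * 'X * q.
rewrite -/(phi q) -[q]coefK poly_def.
have -> : phi (\sum_(i < size q) q`_i *: 'X^i) = \sum_(i < size q) q`_i *: phi 'X^i.
  rewrite /phi raddf_sum !mulr_sumr -sumrB; apply: eq_bigr => i _.
  by rewrite /= derivZ -!scalerAr -scalerBr.
rewrite !linear_sum big1 // => j _; rewrite linearZ /= mulr_algl linearZ /=.
suff -> : E (horner_alg X (phi 'X^j)) = 0 by rewrite /GRing.scale /= mulr0.
(* On monomials the operator reproduces the combination in [semicircle_moment_rec]. *)
have -> : phi 'X^j = (4 * j%:R) *: 'X^(j.-1) - j.+3%:R *: 'X^(j.+1).
  rewrite /phi derivXn; case: (nat_of_ord j) => [|k] /=.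
    by rewrite mulr0n !mulr0 scale0r -!mul_polyC polyC_natr; ring.
  by rewrite -!mul_polyC rmorphM !polyC_natr !exprS -mulr_natl; ring.
rewrite rmorphB /= !linearZ /= !mulr_algl linearB !linearZ /= !rmorphXn /= horner_algX !EX.
have := congr1 (fun x => x%:C) (semicircle_moment_rec R j).
rewrite rmorphB !rmorphM !rmorph_nat rmorph0 => h.
by rewrite -[RHS]h /GRing.scale /= mulrN.
Qed.

Lemma E_chebyshev k : E (horner_alg X (chebyshev _ k.+1)) = 0.
Proof.
have := E_ode (chebyshev _ k.+1)^`(); rewrite chebyshev_ode.
move: (chebyshev _ _) => u.
have -> : - (k.+1%:R * k.+3%:R) * u = (- (k.+1%:R * k.+3%:R) : R[i]) *: u.
  by rewrite -mul_polyC rmorphN rmorphM !rmorph_nat.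
rewrite linearZ /= mulr_algl linearZ /= /GRing.scale /= => /eqP.
by rewrite mulf_eq0 oppr_eq0 mulf_eq0 !pnatr_eq0 /= => /eqP.
Qed.

End semicircular_chebyshev.

(** * Integrals of combinations of boxes *)

Lemma tnth_rev (V : Type) n (t : n.-tuple V) i :
  tnth [tuple of rev t] i = tnth t (rev_ord i).
Proof.
have x0 := tnth t i; rewrite (tnth_nth x0) /= nth_rev ?size_tuple //.
by rewrite (tnth_nth x0).
Qed.

Section lebesgue_tuple_rev.
Variable R : realType.

Lemma setI_box n (u v u' v' : n.-tuple R) : box u v `&` box u' v' =
  box [tuple Num.max (tnth u i) (tnth u' i) | i < n]
      [tuple Num.min (tnth v i) (tnth v' i) | i < n].
Proof.
apply/seteqP; split => t /=.
  move=> [h h'] i; rewrite !tnth_mktuple ge_max le_min.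
  by have /andP[-> ->] := h i; have /andP[-> ->] := h' i.
move=> h; split=> i; have := h i; rewrite !tnth_mktuple ge_max le_min.
  by case/andP => /andP[-> _] /andP[-> _].
by case/andP => /andP[_ ->] /andP[_ ->].
Qed.

(** No order between the corners is imposed, so empty boxes occur and the family is stable under
    intersection. *)
Definition boxes n : set (set (n.-tuple R)) := range (fun uv => box uv.1 uv.2).

Definition cst_tuple n (a : R) : n.-tuple R := [tuple a | i < n].

Lemma boxes_cover n : \bigcup_k box (cst_tuple n (- k%:R)) (cst_tuple n k%:R) = setT.
Proof.
apply/seteqP; split => // t _.
pose M := \sum_(i < n) `|tnth t i|.
exists (Num.truncn M).+1 => // i; rewrite !tnth_mktuple -ler_norml.
apply: (@le_trans _ _ M); last by rewrite ltW // Num.Theory.truncnS_gt.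
by rewrite /M (bigD1 i) //= lerDl sumr_ge0.
Qed.

Lemma measurable_boxes n : measurable = <<s @boxes n >>.
Proof.
apply/seteqP; split; last first.
  apply: smallest_sub; first exact: sigma_algebra_measurable.
  by move=> _ [[u v] _ <-]; exact: measurable_box.
move=> A mA.
suff h : measurable_fun [set: g_sigma_algebraType (@boxes n)]
    (id : g_sigma_algebraType (@boxes n) -> n.-tuple R).
  by have := h measurableT A mA; rewrite setTI preimage_id.
apply/measurable_fun_tnthP => i.
apply: (measurability _ (measurable_realfun.RGenCInfty.measurableE R)) => // _ [_ [x ->] <-].
(* The half-space where coordinate [i] is at least [x] is the union over [k] of the boxes from [u k]
   to the corner with all coordinates [k]. *)
pose u k := [tuple if j == i then x else - k%:R | j < n].
have -> : [set: g_sigma_algebraType (@boxes n)] `&`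
    ((fun t : n.-tuple R => tnth t i) \o id) @^-1` `[x, +oo[ =
    \bigcup_k (box (u k) (cst_tuple n k%:R) : set (g_sigma_algebraType (@boxes n))).
  rewrite setTI; apply/seteqP; split => t /=.
    rewrite in_itv /= andbT => xt.
    have : [set: n.-tuple R] t by [].
    rewrite -boxes_cover => -[k _ tk]; exists k => // j.
    by have := tk j; rewrite !tnth_mktuple => /andP[h1 ->]; case: eqP => [->|_]; rewrite ?xt ?h1.
  by move=> [k _ /(_ i)]; rewrite !tnth_mktuple eqxx in_itv /= andbT => /andP[].
apply: bigcupT_measurable => k; apply: sub_sigma_algebra.
by exists (u k, cst_tuple n k%:R).
Qed.

Definition rev_tuple_map n (t : n.-tuple R) : n.-tuple R := [tuple of rev t].

Lemma measurable_rev_tuple n : measurable_fun setT (@rev_tuple_map n).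
Proof.
apply/measurable_fun_tnthP => i.
rewrite (_ : _ \o _ = fun t => tnth t (rev_ord i)); first exact: measurable_tnth.
by apply/funext => t /=; rewrite tnth_rev.
Qed.

HB.instance Definition _ n := isMeasurableFun.Build _ _ _ _ (@rev_tuple_map n)
  (@measurable_rev_tuple n).

Lemma preimage_rev_box n (u v : n.-tuple R) :
  @rev_tuple_map n @^-1` box u v = box [tuple of rev u] [tuple of rev v].
Proof.
apply/seteqP; split => t /= h i; have := h (rev_ord i).
  by rewrite /rev_tuple_map !tnth_rev rev_ordK.
by rewrite /rev_tuple_map !tnth_rev rev_ordK.
Qed.

Lemma lebesgue_tuple_box_max n (u v : n.-tuple R) :
  lebesgue_tuple R n (box u v) = (\prod_(i < n) Num.max 0 (tnth v i - tnth u i))%:E.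
Proof.
case: (pselect (forall i, tnth u i <= tnth v i)) => [uv|/existsNP[i /negP]].
  rewrite lebesgue_tuple_box //; congr (_%:E); apply: eq_bigr => i _.
  by rewrite max_r // subr_ge0.
rewrite -ltNge => vu; rewrite (bigD1 i) //= max_l ?mul0r; last by rewrite subr_le0 ltW.
rewrite (_ : box u v = set0) ?measure0 //; apply/seteqP; split => // t /(_ i) /andP[h1 h2].
by have := le_lt_trans (le_trans h1 h2) vu; rewrite ltxx.
Qed.

(** Both measures agree on boxes, whose volume is a product over the coordinates, and boxes form a
    generating pi-system with an exhaustion of finite measure. *)
Lemma lebesgue_tuple_rev n (A : set (n.-tuple R)) : measurable A ->
  pushforward (lebesgue_tuple R n) (@rev_tuple_map n) A = lebesgue_tuple R n A.
Proof.
apply: (measure_unique (@boxes n) (fun k => box (cst_tuple n (- k%:R)) (cst_tuple n k%:R))).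
- exact: measurable_boxes.
- move=> _ _ [[u v] _ <-] [[u' v'] _ <-] /=; rewrite setI_box.
  by eexists (_, _).
- by move=> k; exists (cst_tuple n (- k%:R), cst_tuple n k%:R).
- exact: boxes_cover.
- move=> _ [[u v] _ <-] /=.
  rewrite -[LHS]/(lebesgue_tuple R n (@rev_tuple_map n @^-1` box u v)).
  rewrite preimage_rev_box !lebesgue_tuple_box_max.
  congr (_%:E); rewrite (reindex_inj rev_ord_inj); apply: eq_bigr => i _.
  by rewrite !tnth_rev rev_ordK.
- move=> k; set B := box _ _.
  rewrite -[X in (X < _)%E]/(lebesgue_tuple R n (@rev_tuple_map n @^-1` B)).
  by rewrite preimage_rev_box lebesgue_tuple_box_max ltry.
Qed.

End lebesgue_tuple_rev.

Section box_integrals.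
Variables (R : realType) (T : R) (n : nat).
Local Notation mu := (lebesgue_tuple R n).
Local Notation C := (@cube R T n).

Lemma cubeE : C = box (cst_tuple n 0) (cst_tuple n T).
Proof.
by apply/seteqP; split => t h i; have := h i; rewrite !tnth_mktuple.
Qed.

Lemma measurable_cube : measurable C.
Proof. by rewrite cubeE; exact: measurable_box. Qed.

(** The volume of the intersection of two boxes; the maximum with 0 accounts for an empty one. *)
Definition box_overlap (u v u' v' : n.-tuple R) : R :=
  \prod_(i < n) Num.max 0 (Num.min (tnth v i) (tnth v' i) - Num.max (tnth u i) (tnth u' i)).

Lemma integral_sqr_boxes (J : finType) (c : J -> R) (u v : J -> n.-tuple R) :
  (forall j, box (u j) (v j) `<=` C) ->
  (\int[mu]_(t in C) ((\sum_j c j * \1_(box (u j) (v j)) t) ^+ 2)%:E)%E =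
  (\sum_j \sum_k c j * c k * box_overlap (u j) (v j) (u k) (v k))%:E.
Proof.
move=> ucube.
pose B (x : J * J) := box (u x.1) (v x.1) `&` box (u x.2) (v x.2).
have mB x : measurable (B x) by apply: measurableI; exact: measurable_box.
have muB x : mu (B x) = (box_overlap (u x.1) (v x.1) (u x.2) (v x.2))%:E.
  rewrite /B setI_box lebesgue_tuple_box_max; congr (_%:E); apply: eq_bigr => i _.
  by rewrite !tnth_mktuple.
have BI x : B x `&` C = B x by apply: setIidl => t [/ucube].
have intB x : mu.-integrable C (EFin \o \1_(B x)).
  apply/integrableP; split; first exact/measurable_EFinP/measurable_indic.
  rewrite (eq_integral (fun t => (\1_(B x) t)%:E)) => [|t _]; last by rewrite gee0_abs // lee_fin.
  rewrite integral_indic ?BI //; last exact: measurable_cube.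
  by rewrite [X in (X < _)%E](muB x) ltry.
transitivity (\int[mu]_(t in C) \sum_(x : J * J)
    ((c x.1 * c x.2)%:E * (\1_(B x) t)%:E))%E.
  apply: eq_integral => t _; rewrite sumEFin; congr (_%:E).
  rewrite expr2 mulr_suml -(pair_bigA _ (fun j k => c j * c k * \1_(B (j, k)) t)) /=.
  apply: eq_bigr => j _; rewrite mulr_sumr; apply: eq_bigr => k _.
  by rewrite mulrACA /B indicI.
rewrite integral_sum; first 1 last.
- exact: measurable_cube.
- by move=> x; exact: (integrableZl measurable_cube _ (intB x)).
rewrite (pair_bigA _ (fun j k => c j * c k * box_overlap (u j) (v j) (u k) (v k))).
rewrite -sumEFin; apply: eq_bigr => x _.
rewrite (integralZl measurable_cube (intB x)).
rewrite integral_indic ?BI //; last exact: measurable_cube.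
by rewrite [X in (_ * X)%E](muB x) EFinM.
Qed.

(** An approximation of a symmetric function is nearly symmetric: [s] and its reflection are equally
    far from [f], and (y - z)^2 <= 2 (x - y)^2 + 2 (x - z)^2. *)
Lemma integral_reflect_le (f s : n.-tuple R -> R) (e : R) :
  measurable_fun C f -> mirror_symmetric T f -> measurable_fun setT s ->
  (\int[mu]_(t in C) ((f t - s t) ^+ 2)%:E < e%:E)%E ->
  (\int[mu]_(t in C) ((s t - s [tuple of rev t]) ^+ 2)%:E <= (4 * e)%:E)%E.
Proof.
move=> mf fsym ms he.
have mC := measurable_cube.
have msC : measurable_fun C s by exact: measurable_funTS.
have msr : measurable_fun C (fun t => s [tuple of rev t]).
  by apply: measurable_funTS; apply: measurableT_comp ms (@measurable_rev_tuple R n).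
have mh : measurable_fun C (fun t => ((f t - s t) ^+ 2)%:E).
  by apply/measurable_EFinP; apply: measurable_funX; exact: measurable_funB.
have mhr : measurable_fun C (fun t => ((f t - s [tuple of rev t]) ^+ 2)%:E).
  by apply/measurable_EFinP; apply: measurable_funX; exact: measurable_funB.
have hr : (\int[mu]_(t in C) ((f t - s [tuple of rev t]) ^+ 2)%:E =
    \int[mu]_(t in C) ((f t - s t) ^+ 2)%:E)%E.
  have rC : @rev_tuple_map R n @^-1` C = C.
    rewrite cubeE preimage_rev_box; congr box; apply/eq_from_tnth => i;
    by rewrite tnth_rev !tnth_mktuple.
  transitivity (\int[pushforward mu (@rev_tuple_map R n)]_(t in C) ((f t - s t) ^+ 2)%:E)%E.
    rewrite (ge0_integral_pushforward (@measurable_rev_tuple R n)) //; last first.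
      by move=> t _; rewrite lee_fin sqr_ge0.
    by rewrite rC; apply: eq_integral => t /set_mem tC /=; rewrite fsym.
  by apply: eq_measure_integral => /= A mA _; exact: lebesgue_tuple_rev.
apply: (@le_trans _ _ (\int[mu]_(t in C) (2%:E * ((f t - s t) ^+ 2)%:E +
    2%:E * ((f t - s [tuple of rev t]) ^+ 2)%:E))%E).
  apply: ge0_le_integral => //.
  - by move=> t _; rewrite lee_fin sqr_ge0.
  - by apply/measurable_EFinP; apply: measurable_funX; exact: measurable_funB.
  - by apply: emeasurable_funD; apply: measurable_funeM.
  - move=> t _; rewrite -!EFinM -EFinD lee_fin.
    move: (f t) (s t) (s [tuple of rev t]) => x y z; rewrite -subr_ge0.
    have -> : 2 * (x - y) ^+ 2 + 2 * (x - z) ^+ 2 - (y - z) ^+ 2 = (2 * x - y - z) ^+ 2.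
      by ring.
    exact: sqr_ge0.
rewrite ge0_integralD //; first last.
- exact: measurable_funeM.
- by move=> t _; rewrite -EFinM lee_fin mulr_ge0 ?sqr_ge0.
- exact: measurable_funeM.
- by move=> t _; rewrite -EFinM lee_fin mulr_ge0 ?sqr_ge0.
rewrite !ge0_integralZl_EFin //; first last.
- by move=> t _; rewrite lee_fin sqr_ge0.
- by move=> t _; rewrite lee_fin sqr_ge0.
rewrite hr.
have : (0 <= \int[mu]_(t in C) ((f t - s t) ^+ 2)%:E)%E.
  by apply: integral_ge0 => t _; rewrite lee_fin sqr_ge0.
case: (integral _ _ _) he => [r| |] //.
by rewrite lte_fin => re _; rewrite -!EFinM -EFinD lee_fin; lra.
Qed.

End box_integrals.

(** * Discretization of Wigner integrals *)

Section products_of_linear_forms.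
Local Open Scope complex_scope.
Variables (R : realType) (A : algType R[i]) (N : nat) (Y : 'I_N -> A).
Implicit Types (b : 'I_N -> R) (bs : seq ('I_N -> R)) (w : seq 'I_N).

Definition lin b : A := \sum_k (b k)%:C *: Y k.

Definition coef_prod bs w : R := \prod_(x <- zip bs w) x.1 x.2.

(** Disjoint supports kill the contraction term of [mulY_wick], so the ordinary product is already a
    Wick sum. *)
Lemma prod_lin bs : pairwise (fun b b' : 'I_N -> R => [forall k, b k * b' k == 0]) bs ->
  \prod_(b <- bs) lin b = wick_sum Y (size bs) (coef_prod bs).
Proof.
elim: bs => [_|b bs IH] /=.
  rewrite big_nil /wick_sum (sum_tuple0 (fun w => (coef_prod [::] w)%:C *: wick Y w)).
  by rewrite /coef_prod big_nil rmorph1 scale1r.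
move=> /andP[bbs /IH {IH}IH]; rewrite big_cons IH /wick_sum.
rewrite (sum_tupleS _ (fun w => (coef_prod (b :: bs) w)%:C *: wick Y w)) mulr_suml.
apply: eq_bigr => i _; rewrite mulr_sumr; apply: eq_bigr => w _.
rewrite -scalerAl -scalerAr scalerA -rmorphM /coef_prod big_cons.
move: (tval w) (size_tuple w) => {}w; case: w bs bbs {IH} => [|j w] [|b' bs] // bbs _.
  by rewrite wick1 mulr1.
rewrite mulY_wick scalerDr; case: eqP => [<-|_]; last by rewrite scale0r scaler0 addr0.
have /andP[/forallP/(_ i)/eqP bb _] : [forall k, b k * b' k == 0] && all
  (fun b' : 'I_N -> R => [forall k, b k * b' k == 0]) bs by [].
by rewrite [zip _ _]/= big_cons mulrA bb mul0r rmorph0 !scale0r addr0.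
Qed.

Lemma sum_coef_prod bs bs' : size bs' = size bs ->
  \sum_(w : (size bs).-tuple 'I_N) coef_prod bs w * coef_prod bs' w =
  \prod_(x <- zip bs bs') \sum_k x.1 k * x.2 k.
Proof.
elim: bs bs' => [|b bs IH] [|b' bs'] //=.
  rewrite (sum_tuple0 (fun w => coef_prod [::] w * coef_prod [::] w)).
  by rewrite /coef_prod !big_nil mulr1.
move=> [/IH {IH}IH]; rewrite big_cons -IH /=.
rewrite (sum_tupleS _ (fun w => coef_prod (b :: bs) w * coef_prod (b' :: bs') w)).
rewrite mulr_suml; apply: eq_bigr => i _; rewrite mulr_sumr; apply: eq_bigr => w _.
by rewrite /coef_prod !big_cons /= mulrACA.
Qed.

End products_of_linear_forms.

(** * Step functions on a grid and normalized Brownian increments *)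

Section grid.
Variables (R : realType) (N : nat) (t : nat -> R).
Hypothesis t_lt : forall k, (k < N)%N -> t k < t k.+1.

Let t_mono i j : (i <= N)%N -> (j <= N)%N -> (t i <= t j) = (i <= j)%N.
Proof.
move=> iN jN.
have inc a b : (a < b)%N -> (b <= N)%N -> t a < t b.
  elim: b => // b IH; rewrite ltnS leq_eqVlt => /predU1P[->|ab] bN; first exact: t_lt.
  by apply: lt_trans (t_lt bN); apply: IH => //; exact: ltnW.
case: (ltngtP i j) => [ij|ji|->]; last by rewrite lexx.
- by rewrite ltW // inc.
- by rewrite leNgt inc.
Qed.

Definition grid_point (x : R) := exists2 i, (i <= N)%N & x = t i.

Lemma grid_point_max x y : grid_point x -> grid_point y -> grid_point (Num.max x y).
Proof. by move=> hx hy; rewrite /Num.max; case: ifP. Qed.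

Lemma grid_point_min x y : grid_point x -> grid_point y -> grid_point (Num.min x y).
Proof. by move=> hx hy; rewrite /Num.min; case: ifP. Qed.

Lemma sum_grid (V : zmodType) (F : R -> V) x y : grid_point x -> grid_point y -> x <= y ->
  \sum_(k < N | (x <= t k) && (t k < y)) (F (t k.+1) - F (t k)) = F y - F x.
Proof.
move=> [i iN ->] [j jN ->]; rewrite t_mono // => ij.
rewrite -(telescope_sumr (fun k => F (t k)) ij).
rewrite (big_nat_widen _ _ _ _ _ jN) (big_nat_widenl _ 0) // big_mkord.
apply: eq_bigl => k; have kN := ltn_ord k.
by rewrite ltNge !t_mono ?(ltnW kN) // -ltnNge andbC.
Qed.

(** For grid points, the coordinates of the indicator of [x, y) with respect to the L2-normalized
    indicators of the cells; hence the square root. *)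
Definition step x y (k : 'I_N) : R :=
  if (x <= t k) && (t k < y) then Num.sqrt (t k.+1 - t k) else 0.

Lemma sum_step x y x' y' : grid_point x -> grid_point y -> grid_point x' -> grid_point y' ->
  \sum_k step x y k * step x' y' k = Num.max 0 (Num.min y y' - Num.max x x').
Proof.
move=> hx hy hx' hy'.
transitivity (\sum_(k < N | (Num.max x x' <= t k) && (t k < Num.min y y')) (t k.+1 - t k)).
  rewrite [RHS]big_mkcond; apply: eq_bigr => k _; rewrite /step ge_max lt_min.
  have tk : 0 <= t k.+1 - t k by rewrite subr_ge0 ltW // t_lt.
  case: (x <= t k); case: (t k < y); case: (x' <= t k); case: (t k < y');
    by rewrite /= ?mul0r ?mulr0 // -expr2 sqr_sqrtr.
have [le|lt] := leP (Num.max x x') (Num.min y y').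
  by rewrite (sum_grid id (grid_point_max hx hx') (grid_point_min hy hy') le) [RHS]max_r ?subr_ge0.
rewrite [RHS]max_l ?subr_le0 ?ltW // big1 // => k /andP[h1 h2].
by have := lt_trans (le_lt_trans h1 h2) lt; rewrite ltxx.
Qed.

Lemma step_disjoint x y x' y' (k : 'I_N) : ~~ ((x <= t k <= y) && (x' <= t k <= y')) ->
  step x y k * step x' y' k = 0.
Proof.
rewrite /step; case: ifP => [/andP[-> /ltW ->]|_]; last by rewrite mul0r.
by case: ifP => [/andP[-> /ltW ->]|_] //; rewrite mulr0.
Qed.

End grid.

Section brownian_grid.
Local Open Scope complex_scope.
Variables (R : realType) (A : algType R[i]) (star : A -> A) (E : {scalar A}).
Hypothesis hAE : is_Wstar_probability_space star E.
Variables (T : R) (S : R -> A).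
Hypothesis hS : free_brownian_motion star E T S.
Variables (N : nat) (t : nat -> R).
Hypotheses (t_ge0 : 0 <= t 0%N) (t_lt : forall k, (k < N)%N -> t k < t k.+1)
  (t_leT : t N <= T).

Definition increment (k : 'I_N) : A :=
  (Num.sqrt (t k.+1 - t k))^-1%:C *: (S (t k.+1) - S (t k)).

Let t_ge k : (k <= N)%N -> 0 <= t k.
Proof. by elim: k => // k IH kN; apply: le_trans (ltW (t_lt kN)); exact: IH (ltnW kN). Qed.

Let t_le k : (k <= N)%N -> t k <= T.
Proof.
move=> kN; apply: le_trans t_leT; rewrite -(subnKC kN).
have : (k + (N - k) <= N)%N by rewrite subnKC.
elim: (N - k)%N => [|d IH]; first by rewrite addn0.
rewrite addnS => dN; apply: le_trans (ltW (t_lt dN)); exact: IH (ltnW dN).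
Qed.

Let S_sc (k : 'I_N) : semicircular star E (S (t k.+1) - S (t k)) (t k.+1 - t k).
Proof.
by apply: (fbm_semicircular hS); rewrite ?t_ge ?t_le ?(ltW (t_lt _)) // ltnW.
Qed.

(** Rescaling the variable is absorbed into the polynomial, so freeness passes from the increments
    of [S] to the normalized ones. *)
Lemma horner_algZ (c : R[i]) (x : A) (q : {poly R[i]}) :
  horner_alg (c *: x) q = horner_alg x (q \Po (c *: 'X)).
Proof.
elim/poly_ind: q => [|q b IH]; first by rewrite comp_poly0 !rmorph0.
rewrite comp_poly_MXaddC !rmorphD !rmorphM /= IH !horner_algC horner_algX.
by congr (_ * _ + _); rewrite linearZ /= horner_algX mulr_algl.
Qed.

Lemma free_increments : free_semicircular_family star E increment.
Proof.
split=> [k||k j].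
- by rewrite (starZ hAE) conjc_real; have [-> _] := S_sc k.
- move=> m i q iD hq.
  pose q' a := q a \Po ((Num.sqrt (t (i a).+1 - t (i a)))^-1%:C *: 'X).
  have qE a : horner_alg (increment (i a)) (q a) = horner_alg (S (t (i a).+1) - S (t (i a))) (q' a).
    exact: horner_algZ.
  under eq_bigr do rewrite qE.
  apply: (fbm_free hS t_ge0 t_lt t_leT (q := q')) => // a; first by rewrite -qE hq.
- apply: E_chebyshev => l; rewrite exprZn linearZ /=.
  have [_ ->] := S_sc k; rewrite rmorphM rmorphXn /= /GRing.scale /= mulrA -exprMn -rmorphM.
  by rewrite mulVf ?rmorph1 ?expr1n ?mul1r // gt_eqF // sqrtr_gt0 subr_gt0 t_lt.
Qed.

Lemma brownian_lin x y : grid_point N t x -> grid_point N t y -> x <= y ->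
  S y - S x = lin increment (step t x y).
Proof.
move=> hx hy xy; rewrite -(sum_grid t_lt S hx hy xy) big_mkcond.
apply: eq_bigr => k _; rewrite /step /increment.
case: ifP => _; last by rewrite scale0r.
by rewrite scalerA -rmorphM mulfV ?scale1r // gt_eqF // sqrtr_gt0 subr_gt0 t_lt.
Qed.

Section boxes.
Variable p : nat.
Implicit Types (u v : p.-tuple R).

Definition box_coef u v : seq 'I_N -> R :=
  coef_prod [seq step t (tnth u i) (tnth v i) | i <- enum 'I_p].

Definition grid_box u v := forall i,
  [/\ grid_point N t (tnth u i), grid_point N t (tnth v i) & tnth u i <= tnth v i].

Let size_steps u v : size [seq step (N := N) t (tnth u i) (tnth v i) | i <- enum 'I_p] = p.
Proof. by rewrite size_map size_enum_ord. Qed.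

Lemma box_coefE u v (w : p.-tuple 'I_N) :
  box_coef u v w = \prod_(i < p) step t (tnth u i) (tnth v i) (tnth w i).
Proof.
rewrite /box_coef /coef_prod [X in zip _ X](_ : _ = [seq tnth w i | i <- enum 'I_p]).
  by rewrite zip_map big_map big_enum.
by rewrite map_tnth_enum.
Qed.

Lemma box_coef_rev u v w : size w = p ->
  box_coef u v (rev w) = box_coef [tuple of rev u] [tuple of rev v] w.
Proof.
move=> sw; have [w' ->] : exists w' : p.-tuple 'I_N, w = w'.
  by move/eqP: sw => sw; exists (Tuple sw).
rewrite -[rev w']/(tval [tuple of rev w']) !box_coefE (reindex_inj rev_ord_inj).
by apply: eq_bigr => i _; rewrite !tnth_rev rev_ordK.
Qed.

Lemma brownian_box u v : grid_box u v -> box u v `&` @diagonals R p = set0 ->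
  \prod_(i < p) (S (tnth v i) - S (tnth u i)) = wick_sum increment p (box_coef u v).
Proof.
move=> guv diag.
rewrite -[in RHS](size_steps u v) /box_coef -prod_lin.
  rewrite big_map enumT -[in LHS](_ : Finite.enum _ = index_enum _); last by rewrite [RHS]unlock.
  apply: eq_bigr => i _.
  by have [h1 h2 h3] := guv i; rewrite brownian_lin.
rewrite pairwise_map; have := enum_uniq 'I_p; rewrite uniq_pairwise.
apply: sub_pairwise => i j /= ij; apply/forallP => k; apply/eqP.
apply: step_disjoint; apply/negP => /andP[ki kj].
(* If sides [i] and [j] both contained [t k], putting [t k] in these two coordinates would give a
   point of the box on a diagonal. *)
have : (box u v `&` @diagonals R p) [tuple if (l == i) || (l == j) then t k else tnth u l | l < p].
  split=> [l|]; last by exists i, j; split => //; rewrite !tnth_mktuple !eqxx orbT.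
  rewrite tnth_mktuple; case: eqP => [->|_]; first by [].
  by case: eqP => [->|_] //=; have [_ _ ->] := guv l; rewrite lexx.
by rewrite diag.
Qed.

(** The same Gram formula as in [integral_sqr_boxes]: passing from combinations of boxes to kernels
    on the grid is isometric. *)
Lemma sqn_boxes (J : finType) (c : J -> R) (u v : J -> p.-tuple R) :
  (forall j, grid_box (u j) (v j)) ->
  sqn p (fun w => \sum_j c j * box_coef (u j) (v j) w) =
  \sum_j \sum_k c j * c k * box_overlap (u j) (v j) (u k) (v k).
Proof.
move=> guv; rewrite /sqn.
under eq_bigr do rewrite expr2 mulr_suml.
rewrite exchange_big; apply: eq_bigr => j _ /=.
under eq_bigr do rewrite mulr_sumr.
rewrite exchange_big; apply: eq_bigr => k _ /=.
under eq_bigr do rewrite mulrACA.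
rewrite -mulr_sumr; congr (_ * _).
have := sum_coef_prod (etrans (size_steps (u k) (v k)) (esym (size_steps (u j) (v j)))).
rewrite size_steps => ->; rewrite zip_map big_map big_enum.
apply: eq_bigr => i _ /=.
by have [? ? _] := guv j i; have [? ? _] := guv k i; rewrite sum_step.
Qed.

End boxes.

End brownian_grid.

(** * Approximation of Wigner integrals by mirror symmetric Wick sums *)

Section wigner_integral_approximation.
Local Open Scope complex_scope.
Variables (R : realType) (A : algType R[i]) (star : A -> A) (E : {scalar A}).
Hypothesis hAE : is_Wstar_probability_space star E.
Variables (T : R) (S : R -> A) (p : nat).
Hypothesis T0 : 0 <= T.
Hypothesis hS : free_brownian_motion star E T S.
Notation nrm := (nrm star E).

Lemma sorted_grid (s : seq R) : all (fun x => 0 <= x <= T) s ->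
  exists N t, [/\ 0 <= t 0%N, (forall k, (k < N)%N -> t k < t k.+1), t N <= T &
    {in s, forall x, grid_point N t x}].
Proof.
(* Adjoining 0 makes the list nonempty, so its last index is [(size l).-1]. *)
move=> /allP sT; pose l := sort <=%R (undup (0 :: s)).
have lP x : (x \in l) = (x == 0) || (x \in s) by rewrite mem_sort mem_undup inE.
have l0 : (0 < size l)%N by rewrite (@leq_ltn_trans (index 0 l)) // index_mem lP eqxx.
have lT k : (k < size l)%N -> 0 <= nth 0 l k <= T.
  by move/(mem_nth 0); rewrite lP => /predU1P[->|/sT //]; rewrite lexx.
exists (size l).-1, (nth 0 l); split.
- by have /andP[] := lT _ l0.
- move=> k kN; apply: (sortedP 0 (s := l)); last by rewrite -(prednK l0).
  by rewrite lt_sorted_uniq_le sort_uniq undup_uniq sort_le_sorted.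
- by have /andP[] : 0 <= nth 0 l (size l).-1 <= T by apply: lT; rewrite prednK.
- move=> x xs; have xl : x \in l by rewrite lP xs orbT.
  by exists (index x l); rewrite ?nth_index // -ltnS prednK // index_mem.
Qed.

Lemma simple_function_rev m (c : 'I_m -> R) (u v : 'I_m -> p.-tuple R)
    (t : p.-tuple R) : simple_function c u v [tuple of rev t] =
  \sum_j c j * \1_(box [tuple of rev (u j)] [tuple of rev (v j)]) t.
Proof.
apply: eq_bigr => j _; congr (_ * _).
by rewrite -preimage_rev_box !indicE.
Qed.

Lemma measurable_simple_function m (c : 'I_m -> R) (u v : 'I_m -> p.-tuple R) :
  measurable_fun setT (simple_function c u v).
Proof.
apply: measurable_sum => j; apply: measurable_funM; first exact: measurable_cst.
by apply: measurable_indic; exact: measurable_box.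
Qed.

Lemma box_sub_cube n (u v : n.-tuple R) :
  (forall i, 0 <= tnth u i /\ tnth u i <= tnth v i <= T) -> box u v `<=` @cube R T n.
Proof.
move=> uv t tuv i; have [u0 /andP[_ vT]] := uv i; have /andP[h1 h2] := tuv i.
by rewrite (le_trans u0 h1) (le_trans h2 vT).
Qed.

Hypothesis p0 : (0 < p)%N.

Lemma wigner_integral_approximable (f : p.-tuple R -> R) (F : A) :
  square_integrable T f -> mirror_symmetric T f -> is_wigner_integral star E T S f F ->
  approximable star E p F.
Proof.
move=> [mf _] fsym hF d d0.
(* One half of [d] pays for the passage to a simple integral, the other for its symmetrization. *)
have e0 : 0 < (d / 2) ^+ 2 by rewrite exprn_gt0 // divr_gt0.
have [m [c [u [v [[uvT diag _] fs FS]]]]] := hF _ e0.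
pose ends := flatten [seq (u j : seq R) ++ v j | j <- enum 'I_m].
have uends j i : tnth (u j) i \in ends.
  by apply/flatten_mapP; exists j; rewrite ?mem_enum // mem_cat mem_tnth.
have vends j i : tnth (v j) i \in ends.
  by apply/flatten_mapP; exists j; rewrite ?mem_enum // mem_cat mem_tnth orbT.
have endsT : all (fun x => 0 <= x <= T) ends.
  apply/allP => x /flatten_mapP[j _]; rewrite mem_cat => /orP[] /tnthP[i ->];
  have [u0 /andP[h1 h2]] := uvT j i; first by rewrite u0 (le_trans h1 h2).
  by rewrite (le_trans u0 h1) h2.
have [N [t [t0 t_lt tT gt]]] := sorted_grid endsT.
pose Y : 'I_N -> A := increment S t.
have hY : free_semicircular_family star E Y := free_increments hAE hS t0 t_lt tT.
have guv j : grid_box N t (u j) (v j).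
  by move=> i; split; [exact: gt | exact: gt | have [_ /andP[]] := uvT j i].
have grev j : grid_box N t [tuple of rev (u j)] [tuple of rev (v j)].
  by move=> i; rewrite !tnth_rev; exact: guv.
pose a (w : seq 'I_N) := \sum_j c j * box_coef t (u j) (v j) w.
pose a' (w : seq 'I_N) := \sum_j c j * box_coef t [tuple of rev (u j)] [tuple of rev (v j)] w.
have a'E w : size w = p -> a (rev w) = a' w.
  by move=> sw; apply: eq_bigr => j _; rewrite box_coef_rev.
have GE : simple_wigner_integral S c u v = wick_sum Y p a.
  rewrite /simple_wigner_integral /wick_sum /a.
  under [RHS]eq_bigr do rewrite rmorph_sum scaler_suml.
  rewrite exchange_big; apply: eq_bigr => j _.
  rewrite (brownian_box S t_lt (guv j) (diag j)) /wick_sum scaler_sumr.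
  by apply: eq_bigr => w _; rewrite scalerA -rmorphM.
have diff_le : sqn p (fun w => a w - a' w) <= 4 * (d / 2) ^+ 2.
  (* The kernel minus its reflection is treated as a single combination of the boxes and, with
     opposite sign, their reflections, so that both Gram formulas apply to it. *)
  pose c2 (x : bool * 'I_m) := if x.1 then c x.2 else - c x.2.
  pose u2 (x : bool * 'I_m) := if x.1 then u x.2 else [tuple of rev (u x.2)].
  pose v2 (x : bool * 'I_m) := if x.1 then v x.2 else [tuple of rev (v x.2)].
  have g2 x : grid_box N t (u2 x) (v2 x) by rewrite /u2 /v2; case: x.1.
  have C2 x : box (u2 x) (v2 x) `<=` @cube R T p.
    apply: box_sub_cube => i; rewrite /u2 /v2; case: x.1; first exact: uvT.
    by rewrite !tnth_rev; exact: uvT.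
  have split2 (g : p.-tuple R -> p.-tuple R -> R) :
      \sum_(x : bool * 'I_m) c2 x * g (u2 x) (v2 x) =
      \sum_j c j * g (u j) (v j) - \sum_j c j * g [tuple of rev (u j)] [tuple of rev (v j)].
    rewrite -(pair_bigA _ (fun b j => c2 (b, j) * g (u2 (b, j)) (v2 (b, j)))) big_bool /=.
    by rewrite -sumrN; congr (_ + _); apply: eq_bigr => j _; rewrite mulNr.
  rewrite (_ : (fun w => _) =
      fun w : seq 'I_N => \sum_x c2 x * box_coef t (u2 x) (v2 x) w); last first.
    by apply/funext => w; rewrite (split2 (fun u v => box_coef t u v w)).
  rewrite sqn_boxes // -lee_fin -(integral_sqr_boxes c2 C2).
  apply: le_trans (integral_reflect_le mf fsym (measurable_simple_function c u v) fs).
  rewrite le_eqVlt; apply/orP; left; apply/eqP; apply: eq_integral => s _.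
  by rewrite simple_function_rev (split2 (fun u v => \1_(box u v) s)).
(* The simple kernel need not be symmetric; its symmetrization differs from it by half of the
   difference bounded in [diff_le]. *)
pose b w := 2^-1 * (a w + a (rev w)).
have bsym w : size w = p -> b (rev w) = b w by move=> _; rewrite /b revK addrC.
have Fb : nrm (F - wick_sum Y p b) <= d.
  have -> : F - wick_sum Y p b = (F - wick_sum Y p a) + wick_sum Y p (fun w => 2^-1 * (a w - a' w)).
    rewrite [wick_sum Y p a](_ : _ = wick_sum Y p b + wick_sum Y p (fun w => 2^-1 * (a w - a' w))).
      by rewrite opprD addrA subrK.
    rewrite /wick_sum -big_split; apply: eq_bigr => w _ /=.
    rewrite -scalerDl -rmorphD /b a'E ?size_tuple //.
    by congr (_%:C *: _); field.
  apply: le_trans (nrmD hAE _ _) _; rewrite [leRHS](splitr d); apply: lerD.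
    rewrite -(@ler_pXn2r _ 2) ?nnegrE ?nrm_ge0 ?divr_ge0 ?(ltW d0) // ltW //.
    by rewrite -ltcR -(nrm_sq hAE) -GE.
  rewrite -(@ler_pXn2r _ 2) ?nnegrE ?nrm_ge0 ?divr_ge0 ?(ltW d0) //.
  rewrite (nrm_wick_sum hAE hY) sqnZ; lra.
have [s [eps [B [D hG]]]] := mirror_wick_sum_quasi_semicircular hAE hY p0 bsym.
by exists (wick_sum Y p b), s, eps, B, D.
Qed.

End wigner_integral_approximation.

Theorem theorem1p2 (R : realType) (A : algType R[i]) (star : A -> A)
    (E : {scalar A}) (hAE : is_Wstar_probability_space star E)
    (T : R) (hT : 0 < T) (p : nat) (hp : (2 <= p)%N)
    (S : R -> A) (hS : free_brownian_motion star E T S)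
    (f : nat -> p.-tuple R -> R)
    (hf : forall n, square_integrable T (f n))
    (hfsym : forall n, mirror_symmetric T (f n))
    (F : nat -> A) (hF : forall n, is_wigner_integral star E T S (f n) (F n))
    (hF2 : E (F n ^+ 2) @[n --> \oo] --> (1 : R[i]^o))
    (S1 : A) (hS1 : semicircular star E S1 1) :
  ((forall k : nat, (3 <= k)%N ->
      E (F n ^+ k) @[n --> \oo] --> (E (S1 ^+ k) : R[i]^o)) <->
   E (F n ^+ 4) @[n --> \oo] --> (E (S1 ^+ 4) : R[i]^o)) /\
  E (S1 ^+ 4) = 2.
Proof.
(* From here on, the law of [S1] enters through these identities. *)
have cheb j : E (horner_alg S1 (chebyshev _ j.+1)) = 0.
  by apply: E_chebyshev => k; have [_ ->] := hS1; rewrite sqrtr1 expr1n mul1r.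
have E4 : E (S1 ^+ 4) = 2 := chebyshev_moment4 hAE cheb.
split; last exact: E4.
split=> [h|F4]; first exact: (h 4%N).
move=> k _; rewrite E4 in F4.
have hA n : approximable star E p (F n).
  exact: (wigner_integral_approximable hAE (ltW hT) hS (ltnW hp) (hf n) (hfsym n) (hF n)).
exact: (fourth_moment_approximable hAE cheb hA hF2 F4).
Qed.
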